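(* Let $(R,\mathfrak{m})$ be a Noetherian local ring with infinite residue field, let $\mathfrak{q}$ be an $\mathfrak{m}$-primary ideal of $R$, and let $\mathbb{M}=\{M_n\}_{n\ge 0}$ be a good $\mathfrak{q}$-filtration of a finitely generated $R$-module $M$ of dimension two with $\operatorname{depth} M>0$. Suppose $J=(a_1,a_2)$ is the ideal of $R$ generated by a maximal $\mathbb{M}$-superficial sequence $a_1,a_2$ for $\mathfrak{q}$. Then $$e_2(\mathbb{M})\ge -\binom{s+2}{2}\,\lambda\!\left(\frac{a_1M:_M a_2}{a_1M}\right),$$ where $s$ is the postulation number of the Ratliff-Rush filtration $\widetilde{\mathbb{M}}$ associated to $\mathbb{M}$.
   Context: $\lambda(-)$ denotes length as an $R$-module. A $\mathfrak{q}$-filtration of $M$ is a chain of submodules $M=M_0\supseteq M_1\supseteq M_2\supseteq\cdots$ with $\mathfrak{q}M_n\subseteq M_{n+1}$ for all $n\ge 0$; it is good if $\mathfrak{q}M_n=M_{n+1}$ for all sufficiently large $n$. For a submodule $N\subseteq M$, $\mathbb{M}/N$ denotes the good $\mathfrak{q}$-filtration $\{(M_n+N)/N\}$ of $M/N$. Hilbert coefficients: with $d=\dim M$, the Hilbert function is $H_{\mathbb{M}}(n)=\lambda(M_n/M_{n+1})$ for $n\ge 0$ (and $H_{\mathbb{M}}(n)=0$ for $n<0$), and the Hilbert series is $P_{\mathbb{M}}(t)=\sum_{n\ge0}H_{\mathbb{M}}(n)t^n=h_{\mathbb{M}}(t)/(1-t)^d$ with $h_{\mathbb{M}}(t)\in\mathbb{Z}[t]$,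 $h_{\mathbb{M}}(1)\ne0$. For every $i\ge 0$, $e_i(\mathbb{M}):=h_{\mathbb{M}}^{(i)}(1)/i!$ (where $h_{\mathbb{M}}^{(i)}$ is the $i$-th derivative). The Hilbert polynomial is $p_{\mathbb{M}}(X)=\sum_{i=0}^{d-1}(-1)^i e_i(\mathbb{M})\binom{X+d-i-1}{d-i-1}\in\mathbb{Q}[X]$. The postulation number of a good $\mathfrak{q}$-filtration $\mathbb{M}$ is the largest integer $n$ such that $H_{\mathbb{M}}(n)\ne p_{\mathbb{M}}(n)$. Ratliff-Rush filtration: $\widetilde{\mathbb{M}}=\{\widetilde{M}_n\}_{n\ge0}$ with $\widetilde{M}_n:=\bigcup_{k\ge1}(M_{n+k}:_M\mathfrak{q}^k)$; it is a good $\mathfrak{q}$-filtration of $M$. Superficial sequences: an element $a\in\mathfrak{q}$ is $\mathbb{M}$-superficial for $\mathfrak{q}$ if there is an integer $c\ge 0$ such that $(M_{n+1}:_M a)\cap M_c=M_n$ for all $n\ge c$. A sequence $a_1,\dots,a_r$ is an $\mathbb{M}$-superficial sequence for $\mathfrak{q}$ if for each $i=1,\dots,r$ the element $a_i$ is $\mathbb{M}/(a_1,\dots,a_{i-1})M$-superficial for $\mathfrak{q}$. It is maximal if $r=\dim M$. For a submodule $N\subseteq M$ and an element or ideal $I$ of $R$, $N:_M I=\{x\in M: Ix\subseteq N\}$. *)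

(* Defs.v *)
From HB Require Import structures.
From mathcomp Require Import all_boot all_order all_algebra.
From mathcomp Require Import boolp classical_sets cardinality.
Set Implicit Arguments.
Unset Strict Implicit.
Unset Printing Implicit Defensive.
Import Order.TTheory GRing.Theory Num.Theory.
Local Open Scope classical_set_scope.
Local Open Scope quotient_scope.
Local Open Scope ring_scope.

Section Submodules.
Variables (R : comNzRingType) (V : lmodType R).
Implicit Types (A N : set V) (I : set R).

Definition submodule N : Prop :=
  N 0 /\ forall (a : R) (u v : V), N u -> N v -> N (a *: u + v).

Definition span A : set V := smallest submodule A.

Definition finitely_generated N : Prop := exists s : seq V, span [set` s] = N.

(* [I N]: finite sums of products, not the mere set of products *)
Definition smul I N : set V := span [set a *: x | a in I & x in N].

(* [N :_V I]; for an element [a] take [I = [set a]] *)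
Definition colon N I : set V := [set x | forall a, I a -> N (a *: x)].

Lemma submodule_span A : submodule (span A).
Proof.
split=> [N [[]] //|a u v Au Av N AN]; case: (AN) => -[_ + _]; apply.
- exact: Au.
- exact: Av.
Qed.

End Submodules.

Section QuotientModule.
Variables (R : comNzRingType) (V : lmodType R) (A : set V).

Definition span_pred : {pred V} := [pred x | x \in span A].

Lemma span_pred_zmod : zmod_closed span_pred.
Proof.
have [S0 SD] := submodule_span A.
split=> [|u v]; rewrite !inE // => Au Av.
by rewrite addrC -scaleN1r; apply: SD.
Qed.
HB.instance Definition _ := GRing.isZmodClosed.Build V span_pred span_pred_zmod.

(* [V / N], for an arbitrary subset [A] in place of a submodule [N]: this is
   the quotient by the submodule generated by [A], hence [V / A] as soon as [A]
   is a submodule *)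
Definition quotmod : Type := Quotient.quot span_pred.
HB.instance Definition _ := GRing.Zmodule.on quotmod.
HB.instance Definition _ := EqQuotient.on quotmod.

Definition scaleq (a : R) (x : quotmod) : quotmod :=
  \pi_quotmod (a *: repr x).

Lemma quotmodP (u v : V) :
  (\pi_quotmod u = \pi_quotmod v) <-> span A (u - v).
Proof.
by split=> [/eqmodP|uv]; last apply/eqmodP;
  rewrite /= /Quotient.equiv /span_pred !inE.
Qed.

Lemma piD (u v : V) :
  \pi_quotmod (u + v) = \pi_quotmod u + \pi_quotmod v.
Proof. exact: (@Quotient.pi_add V span_pred). Qed.

Lemma pi_scaleq (a : R) (u : V) :
  scaleq a (\pi_quotmod u) = \pi_quotmod (a *: u).
Proof.
apply/quotmodP; rewrite -scalerBr; have [S0 SD] := submodule_span A.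
rewrite -[_ *: _]addr0; apply: SD => //.
by apply/quotmodP; rewrite reprK.
Qed.

Lemma scaleqA (a b : R) (x : quotmod) :
  scaleq a (scaleq b x) = scaleq (a * b) x.
Proof. by rewrite -[x]reprK !pi_scaleq scalerA reprK. Qed.

Lemma scale1q : left_id 1 scaleq.
Proof. by move=> x; rewrite -[x]reprK pi_scaleq scale1r. Qed.

Lemma scaleqDr : right_distributive scaleq +%R.
Proof.
by move=> a x y; rewrite -[x]reprK -[y]reprK -piD !pi_scaleq scalerDr piD.
Qed.

Lemma scaleqDl (x : quotmod) : {morph scaleq^~ x : a b / a + b}.
Proof. by move=> a b; rewrite -[x]reprK !pi_scaleq scalerDl piD. Qed.

HB.instance Definition _ := GRing.Zmodule_isLmodule.Build R quotmod
  scaleqA scale1q scaleqDr scaleqDl.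

(* [(L + A) / A] as a subset of [V / A] *)
Definition quot_image (L : set V) : set quotmod := \pi_quotmod @` L.

End QuotientModule.
Arguments quot_image {R V} A L.

Section LocalRings.
Variable R : comNzRingType.
Implicit Types (I P m q : set R).

Definition ideal I : Prop := submodule (I : set R^o).

Definition ideal_gen (A : set R) : set R := span (A : set R^o).

Definition noetherian : Prop :=
  forall I, ideal I -> finitely_generated (I : set R^o).

Definition maximal_ideal m : Prop :=
  [/\ ideal m, m != setT &
      forall I, ideal I -> I != setT -> m `<=` I -> I = m].

Definition local_ring m : Prop :=
  maximal_ideal m /\ forall I, maximal_ideal I -> I = m.

Definition prime_ideal P : Prop :=
  [/\ ideal P, P != setT & forall a b, P (a * b) -> P a \/ P b].

Definition radical I : set R := [set a | exists n, I (a ^+ n)].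

Definition primary_ideal m q : Prop :=
  [/\ ideal q, q != setT,
      forall a b, q (a * b) -> q a \/ exists n, q (b ^+ n) &
      radical q = m].

Definition infinite_residue_field m : Prop :=
  infinite_set [set: quotmod (m : set R^o)].

Definition ideal_exp (I : set R) (k : nat) : set R :=
  iter k (fun K => smul I (K : set R^o)) setT.

End LocalRings.

Section Invariants.
Variables (R : comNzRingType) (V : lmodType R).

Definition strict_chain (T : Type) (C : nat -> set T) (k : nat) : Prop :=
  forall i, (i < k)%N -> C i `<` C i.+1.

(* In the three definitions below, [supremum 0] is 0 on an empty or unbounded
   set; lengths of interest are finite. *)

(* length of the submodule [L] *)
Definition length (L : set V) : nat :=
  supremum 0%N [set k | exists C : nat -> set V,
    (forall i, (i <= k)%N -> submodule (C i) /\ C i `<=` L) /\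
    strict_chain C k].

Definition annihilator : set R := [set a | forall x : V, a *: x = 0].

(* Krull dimension of [R / Ann V] *)
Definition krull_dim : nat :=
  supremum 0%N [set k | exists C : nat -> set R,
    (forall i, (i <= k)%N -> prime_ideal (C i) /\ annihilator `<=` C i) /\
    strict_chain C k].

(* [(a_0, ..., a_(i-1)) V] *)
Definition prefix_mul (s : seq R) (i : nat) : set V :=
  smul (ideal_gen [set` take i s]) [set: V].

Definition regular_sequence (s : seq R) : Prop :=
  (forall i, (i < size s)%N -> forall x : quotmod (prefix_mul s i),
     s`_i *: x = 0 -> x = 0) /\
  prefix_mul s (size s) != setT.

Definition depth (m : set R) : nat :=
  supremum 0%N [set k | exists s : seq R,
    [/\ size s = k, [set` s] `<=` m & regular_sequence s]].

End Invariants.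
Arguments prefix_mul {R} V s i.

Definition length_quot (R : comNzRingType) (V : lmodType R) (L N : set V) :
  nat := length (quot_image N L).

Section Filtrations.
Variables (R : comNzRingType) (V : lmodType R) (q : set R).
Implicit Types (F : nat -> set V).

Definition filtration F : Prop :=
  [/\ F 0%N = setT, forall n, submodule (F n), forall n, F n.+1 `<=` F n &
      forall n, smul q (F n) `<=` F n.+1].

Definition good_filtration F : Prop :=
  filtration F /\ exists n0, forall n, (n0 <= n)%N -> smul q (F n) = F n.+1.

Definition quot_filtration (N : set V) F : nat -> set (quotmod N) :=
  fun n => quot_image N (F n).

Definition ratliff_rush F : nat -> set V :=
  fun n => \bigcup_(k in [set k | (1 <= k)%N])
             colon (F (n + k)%N) (ideal_exp q k).

Definition superficial F (a : R) : Prop :=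
  q a /\ exists c : nat, forall n, (c <= n)%N ->
    colon (F n.+1) [set a] `&` F c = F n.

End Filtrations.
Arguments quot_filtration {R V} N F n.

Definition superficial_sequence (R : comNzRingType) (V : lmodType R)
    (q : set R) (F : nat -> set V) (s : seq R) : Prop :=
  forall i, (i < size s)%N ->
    superficial q (quot_filtration (prefix_mul V s i) F) s`_i.

Definition maximal_superficial_sequence (R : comNzRingType) (V : lmodType R)
    (q : set R) (F : nat -> set V) (s : seq R) : Prop :=
  superficial_sequence q F s /\ size s = krull_dim V.

Section HilbertCoefficients.
Variables (R : comNzRingType) (V : lmodType R) (F : nat -> set V).

Definition hilbert_fun (n : int) : nat :=
  if n is Posz k then length_quot (F k) (F k.+1) else 0%N.

(* [(1 - t)^d P(t) = h(t)], read off coefficientwise: the n-th coefficient only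
   involves the truncation of the series [P] at degree [n] *)
Definition is_hilbert_numerator (h : {poly int}) : Prop :=
  h.[1] != 0 /\
  forall n : nat, ((1 - 'X) ^+ krull_dim V *
    \poly_(i < n.+1) (hilbert_fun i)%:Z)`_n = h`_n.

(* such an [h] is unique, and exists for the filtrations of interest *)
Definition hilbert_numerator : {poly int} := xget 0 is_hilbert_numerator.

Definition hilbert_coef (i : nat) : int := hilbert_numerator^`N(i).[1].

(* [binom(X, k)] *)
Definition binomial_poly (k : nat) : {poly rat} :=
  (k`!%:R)^-1 *: \prod_(j < k) ('X - j%:R%:P).

Definition hilbert_poly : {poly rat} :=
  \sum_(i < krull_dim V)
    ((-1) ^+ i * (hilbert_coef i)%:~R) *:
    (binomial_poly (krull_dim V - i - 1) \Po
       ('X + (krull_dim V - i - 1)%:R%:P)).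

Definition postulation_number : int :=
  xget 0 [set n : int | (hilbert_fun n)%:R != hilbert_poly.[n%:~R] /\
    forall k : int, (hilbert_fun k)%:R != hilbert_poly.[k%:~R] -> k <= n].

End HilbertCoefficients.

(* Main.v *)
Require Import Defs.
From HB Require Import structures.
From mathcomp Require Import all_boot all_order all_algebra.
From mathcomp Require Import boolp classical_sets cardinality.
From mathcomp Require Import zify ring lra.
Set Implicit Arguments.
Unset Strict Implicit.
Unset Printing Implicit Defensive.
Import Order.TTheory GRing.Theory Num.Theory.
Local Open Scope classical_set_scope.
Local Open Scope ring_scope.
Local Notation span := Defs.span.

(** Write [E] for the Ratliff-Rush filtration of [M], [H] for its Hilbert
    function, [p] for its Hilbert polynomial and [lambda] for the length of
    [(a1 M : a2) / a1 M].

    Passing from [F] to [E] changes neither [e_2] nor the other coefficients: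
    positive depth makes [a1] regular on [M], hence [F n.+1 : a1 = F n] for
    large [n] ([regular_superficial_colon]); then [E n] is
    [F (n + n0) : a1 ^+ n0] for a fixed [n0] ([ratliff_rushE]), so that [E] and
    [F] agree in large degree, and the Hilbert coefficients in dimension two
    can be read from the lengths of [M / F n] for large [n]
    ([hilbert_coef2_eq]). What is gained is [E n.+1 : a1 = E n] for all [n],
    not only for large [n].

    Put [L n = E n + a1 M]. Because of this gain, [M / L n.+1] has length
    [H n]. Multiplication by [a2] from [M / L n] to [M / L n.+1] has cokernel
    [M / (a2 M + L n.+1)], whose length grows with [n]. For large [n] its kernel
    is the image of [a1 M : a2], of length at most [lambda], so that the cokernel
    has length at most [e_0 + lambda]; therefore [H n.+1 - H n <= e_0 + lambda]
    for all [n] ([hilbert_growth]).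

    Since [p n.+1 - p n = e_0], the difference [G = H - p] increases by at most
    [lambda] at each step. It vanishes beyond the postulation number [s], so
    [G k >= - (s + 1 - k) lambda] for [k <= s]. Now [e_2] is the sum of the
    [G k] over [k >= 0], since for large [n] the length of [M / E n.+1] is
    ['C(n + 2, 2) e_0 - (n + 1) e_1 + e_2] whereas [p] contributes the first two
    terms. Adding up, [e_2 >= - 'C(s + 2, 2) lambda] ([hilbert_coef2_ge]).

    Finite length, the lemma of Nakayama and the intersection theorem of Krull
    all come from maximal elements in families of submodules. The one form of
    the Artin-Rees lemma that is needed, [artin_rees], is topological: if
    [D / D'] is killed by powers of the elements of [q], then [F n `&` D] is in
    [D'] for some [n]. *)

(** * Submodules and the ascending chain condition *)

Section Submodules.
Variables (R : comNzRingType) (V : lmodType R).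
Implicit Types (N L K C D : set V).

Lemma submodule0 N : submodule N -> N 0.
Proof. by case. Qed.

Lemma submoduleD N u v : submodule N -> N u -> N v -> N (u + v).
Proof. by move=> [_ sN] Nu Nv; rewrite -[u]scale1r; apply: sN. Qed.

Lemma submoduleZ N a u : submodule N -> N u -> N (a *: u).
Proof. by move=> [N0 sN] Nu; rewrite -[_ *: _]addr0; apply: sN. Qed.

Lemma submoduleB N u v : submodule N -> N u -> N v -> N (u - v).
Proof.
by move=> sN Nu Nv; apply: submoduleD; rewrite // -scaleN1r; apply: submoduleZ.
Qed.

Lemma submodule_setT : submodule [set: V].
Proof. by []. Qed.

Lemma submodule_set0 : submodule [set (0 : V)].
Proof. by split=> // a u v -> ->; rewrite scaler0 addr0. Qed.

Lemma submodule_setI N L : submodule N -> submodule L -> submodule (N `&` L).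
Proof.
move=> [N0 sN] [L0 sL]; split=> // a u v [Nu Lu] [Nv Lv].
by split; [apply: sN | apply: sL].
Qed.

Definition sumset N L : set V :=
  [set x | exists u v, [/\ N u, L v & x = u + v]].

Definition scaleset (a : R) N : set V := [set a *: x | x in N].

Lemma submodule_sumset N L :
  submodule N -> submodule L -> submodule (sumset N L).
Proof.
move=> [N0 sN] [L0 sL]; split; first by exists 0, 0; rewrite addr0.
move=> a x y [u [v [Nu Lv ->]]] [u' [v' [Nu' Lv' ->]]].
exists (a *: u + u'), (a *: v + v'); split; [exact: sN | exact: sL |].
by rewrite scalerDr addrACA.
Qed.

Lemma submodule_scaleset a N : submodule N -> submodule (scaleset a N).
Proof.
move=> [N0 sN]; split; first by exists 0; rewrite ?scaler0.
move=> b _ _ [x Nx <-] [y Ny <-]; exists (b *: x + y); first exact: sN.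
by rewrite scalerDr !scalerA mulrC.
Qed.

Lemma submodule_colon N (I : set R) : submodule N -> submodule (colon N I).
Proof.
move=> sN; split=> [a _|b u v Nu Nv a Ia].
  by rewrite scaler0; apply: submodule0.
rewrite scalerDr scalerA mulrC -scalerA.
by apply: submoduleD => //; [apply: submoduleZ => //; apply: Nu | apply: Nv].
Qed.

Lemma colon1E N a : colon N [set a] = [set x | N (a *: x)].
Proof.
by apply/seteqP; split=> x /= h; [apply: h | move=> b ->].
Qed.

Lemma sumset_subl N L : submodule L -> N `<=` sumset N L.
Proof.
by move=> sL x Nx; exists x, 0; rewrite addr0; split=> //; apply: submodule0.
Qed.

Lemma sumset_subr N L : submodule N -> L `<=` sumset N L.
Proof.
by move=> sN x Lx; exists 0, x; rewrite add0r; split=> //; apply: submodule0.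
Qed.

Lemma sumset_subset N L K :
  submodule K -> N `<=` K -> L `<=` K -> sumset N L `<=` K.
Proof.
move=> sK NK LK _ [u [v [Nu Lv ->]]].
by apply: submoduleD; [|apply: NK|apply: LK].
Qed.

Lemma sumsetS N N' L L' :
  N `<=` N' -> L `<=` L' -> sumset N L `<=` sumset N' L'.
Proof.
move=> NN' LL' _ [u [v [Nu Lv ->]]].
by exists u, v; split; [apply: NN' | apply: LL' |].
Qed.

Lemma span_subset (A : set V) N : submodule N -> A `<=` N -> span A `<=` N.
Proof. by move=> sN AN; apply: smallest_sub. Qed.

Lemma subset_span (A : set V) : A `<=` span A.
Proof. exact: sub_gen_smallest. Qed.

Lemma span_submodule N : submodule N -> span N = N.
Proof. by move=> sN; apply: smallest_id. Qed.

Lemma spanS (A B : set V) : A `<=` B -> span A `<=` span B.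
Proof.
move=> AB; apply: (span_subset (submodule_span B)) => x /AB.
exact: subset_span.
Qed.

Lemma span_cons b (s : seq V) x : span [set` b :: s] x ->
  exists a y, span [set` s] y /\ x = a *: b + y.
Proof.
have [S0 SD] := submodule_span [set` s].
pose N := [set x | exists (a : R) y, span [set` s] y /\ x = a *: b + y].
have sN : submodule N.
  split=> [|c u v [a [y [sy ->]]] [a' [y' [sy' ->]]]].
    by exists 0, 0; rewrite scale0r addr0.
  exists (c * a + a'), (c *: y + y'); split; first exact: SD.
  by rewrite scalerDr scalerDl scalerA addrACA.
apply: (span_subset sN) => y /=; rewrite inE => /orP[/eqP->|sy].
  by exists 1, 0; rewrite scale1r addr0.
by exists 0, y; rewrite scale0r add0r; split=> //; apply: subset_span.
Qed.

End Submodules.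

Section Noetherian.
Variables (R : comNzRingType) (V : lmodType R).
Implicit Types (N L K C D : set V).

Definition noetherian_module : Prop :=
  forall N, submodule N -> finitely_generated N.

(** The union of a strictly ascending sequence would be finitely generated, and
    its generators would already lie in one term. *)
Lemma maximal_submodule (P : set (set V)) :
  noetherian_module -> (forall N, P N -> submodule N) -> P !=set0 ->
  exists2 N, P N & forall L, P L -> N `<=` L -> L `<=` N.
Proof.
move=> nV Psub [N0 PN0]; apply: contrapT => nomax.
have step (N : {N | P N}) : exists L : {N | P N}, proj1_sig N `<` proj1_sig L.
  apply: contrapT => nL; apply: nomax; exists (proj1_sig N); first exact: proj2_sig.
  move=> L PL NL; apply: contrapT => LN; apply: nL.
  by exists (exist _ L PL).
have [f fP] := choice step.
pose C k := proj1_sig (iter k f (exist _ N0 PN0)).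
have sC k : submodule (C k) by apply: Psub; apply: proj2_sig.
have Cmono i j : (i <= j)%N -> C i `<=` C j.
  elim: j => [|j IH]; first by rewrite leqn0 => /eqP->.
  rewrite leq_eqVlt => /orP[/eqP->//|/IH/subset_trans]; apply.
  by have [] := fP (iter j f (exist _ N0 PN0)).
pose U := \bigcup_k C k.
have sU : submodule U.
  split=> [|a u v [i _ Cu] [j _ Cv]]; first by exists 0%N => //; apply: submodule0.
  exists (maxn i j) => //; apply: submoduleD => //.
    by apply: submoduleZ => //; apply: Cmono Cu; apply: leq_maxl.
  by apply: Cmono Cv; apply: leq_maxr.
have [s sU_eq] := nV U sU.
have [k sk] : exists k, [set` s] `<=` C k.
  have : [set` s] `<=` U by rewrite -sU_eq; apply: subset_span.
  elim: {sU_eq} s => [|b s IH] sU'; first by exists 0%N.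
  have [k sk] : exists k, [set` s] `<=` C k.
    by apply: IH => x xs; apply: sU'; rewrite /= inE xs orbT.
  have [i _ Cb] : U b by apply: sU'; rewrite /= mem_head.
  exists (maxn i k) => x /=; rewrite inE => /orP[/eqP->|xs].
    by apply: Cmono Cb; apply: leq_maxl.
  by apply: Cmono (sk _ xs); apply: leq_maxr.
have [_ []] := fP (iter k f (exist _ N0 PN0)).
move=> x Cx; apply: (span_subset (sC k) sk); rewrite sU_eq.
by exists k.+1.
Qed.

(** Induction on a number of generators of [V]: for a submodule [N] of
    [span (b :: s)], the coefficients of [b] in elements of [N] form an ideal,
    and what remains of [N] lies in [span s]. *)
Lemma finitely_generated_noetherian :
  noetherian R -> finitely_generated [set: V] -> noetherian_module.
Proof.
move=> nR [s0 s0T] N0 sN0.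
suff H (s : seq V) N : submodule N -> N `<=` span [set` s] ->
    finitely_generated N by apply: (H s0) => //; rewrite s0T.
elim: s N => [|b s IH] N sN Ns.
  exists [::]; apply/seteqP; split; first by apply: span_subset.
  by move=> x /Ns.
have sS := submodule_span [set` s].
pose I : set R := [set a | exists y, span [set` s] y /\ N (a *: b + y)].
have [t tI] : finitely_generated (I : set R^o).
  apply: nR; split=> [|a u v [y [sy Ny]] [y' [sy' Ny']]].
    exists 0; rewrite scale0r addr0.
    by split; apply: submodule0.
  exists (a *: y + y'); split; first by case: sS => _; apply.
  rewrite /= scalerDl -scalerA addrACA -scalerDr.
  by case: sN => _; apply.
have /choice[g gP] : forall a : R, exists x,
    I a -> N x /\ span [set` s] (x - a *: b).
  move=> a; have [[y [sy Ny]]|nIa] := pselect (I a); last by exists 0.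
  by exists (a *: b + y) => _; split=> //; rewrite addrC addKr.
have [v vN] : finitely_generated (N `&` span [set` s]).
  by apply: IH; [apply: submodule_setI | move=> x []].
have sub_I a : a \in t -> I a.
  by move=> ta; rewrite -tI; apply: (@subset_span R R^o).
exists (map g t ++ v); apply/seteqP; split.
  apply: span_subset => // x /=; rewrite mem_cat => /orP[/mapP[a ta ->]|xv].
    by have [] := gP a (sub_I _ ta).
  have : (N `&` span [set` s]) x by rewrite -vN; apply: subset_span.
  by case.
move=> x Nx; have [a [y [sy x_eq]]] := span_cons (Ns _ Nx).
have Ia : I a by exists y; rewrite -x_eq.
have sg := submodule_span [set` map g t].
have [w [gw sw]] : exists w, span [set` map g t] w /\ span [set` s] (w - a *: b).
  move: Ia; rewrite -tI => {}Ia.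
  pose Q : set R^o :=
    [set a : R | exists w, span [set` map g t] w /\ span [set` s] (w - a *: b)].
  suff: Q a by [].
  move: a Ia {x_eq}; apply: smallest_sub.
    split=> [|c a1 a2 [w1 [gw1 sw1]] [w2 [gw2 sw2]]].
      by exists 0; rewrite scale0r subr0; split; apply: submodule0.
    exists (c *: w1 + w2); split; first by case: sg => _; apply.
    rewrite scalerDl -scalerA opprD addrACA -scalerBr.
    by case: sS => _; apply.
  move=> a ta; exists (g a); split; last by have [] := gP a (sub_I _ ta).
  by apply: subset_span => /=; apply: map_f.
have Nw : N w.
  apply: (span_subset sN _ gw) => _ /= /mapP[c ct ->].
  by have [] := gP c (sub_I _ ct).
have sgv := submodule_span [set` map g t ++ v].
rewrite -[x](subrK w); apply: (submoduleD sgv).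
  apply: (@spanS R V [set` v]) => [z /= zv|]; first by rewrite mem_cat zv orbT.
  rewrite vN; split; first exact: submoduleB.
  have -> : x - w = y - (w - a *: b) by rewrite x_eq opprB addrCA addrA.
  exact: submoduleB sS sy sw.
by apply: (spanS _ gw) => z /= zg; rewrite mem_cat zg.
Qed.

End Noetherian.

(** * Local algebra: Nakayama, Artin-Rees and Krull *)

Section LocalAlgebra.
Variables (R : comNzRingType) (m : set R) (V : lmodType R).
Hypotheses (nR : noetherian R) (locR : local_ring m).
Hypothesis nV : noetherian_module V.
Implicit Types (N L K C D A : set V) (q : set R).

Definition line (x : V) : set V := [set r *: x | r in [set: R]].

Lemma submodule_line x : submodule (line x).
Proof.
split=> [|a _ _ [r _ <-] [r' _ <-]]; first by exists 0; rewrite ?scale0r.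
by exists (a * r + r'); rewrite // scalerDl scalerA.
Qed.

Lemma line_id x : line x x.
Proof. by exists 1; rewrite ?scale1r. Qed.

Lemma line_subset N x : submodule N -> N x -> line x `<=` N.
Proof. by move=> sN Nx _ [r _ <-]; apply: submoduleZ. Qed.

Lemma smul_in q D a x : q a -> D x -> smul q D (a *: x).
Proof. by move=> qa Dx; apply: subset_span; exists a => //; exists x. Qed.

Lemma submodule_smul q D : submodule (smul q D).
Proof. exact: submodule_span. Qed.

Lemma smul_subset q D K : submodule K ->
  (forall a x, q a -> D x -> K (a *: x)) -> smul q D `<=` K.
Proof. by move=> sK qDK; apply: span_subset => // _ [a qa [x Dx <-]]; apply: qDK. Qed.

Lemma local_unit a : ~ m a -> exists b, b * a = 1.
Proof.
move=> nma; apply: contrapT => na.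
pose P (I : set R^o) := [/\ ideal I, ~ I 1 & I a].
have [I [idI nI1 Ia] Imax] : exists2 I, P I &
    forall J, P J -> I `<=` J -> J `<=` I.
  apply: maximal_submodule => //; first by move=> I [].
  exists [set b * a | b in [set: R]]; split; last by exists 1; rewrite ?mul1r.
    split=> [|c _ _ [r _ <-] [r' _ <-]]; first by exists 0; rewrite ?mul0r.
    by exists (c * r + r'); rewrite // mulrDl -mulrA.
  by move=> [b _ ba]; apply: na; exists b.
apply: nma; rewrite -(locR.2 I) //; split=> // [|J idJ JT IJ].
  by apply/eqP => IT; apply: nI1; rewrite IT.
apply/seteqP; split=> //; apply: Imax => //; split=> //; last exact: IJ.
move=> J1; move/eqP: JT; apply; apply/seteqP; split=> // r _.
by have := submoduleZ r idJ J1; rewrite /GRing.scale /= mulr1.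
Qed.

Lemma local_1N a r : m a -> ~ m (1 - r * a).
Proof.
have [[idm mT _] _] := locR; move=> ma m1; move/eqP: mT; apply.
have : m 1.
  rewrite -[1](subrK (r * a)); apply: (submoduleD idm) => //.
  exact: (submoduleZ r idm).
move=> {}m1; apply/seteqP; split=> // b _.
by have := submoduleZ b idm m1; rewrite /GRing.scale /= mulr1.
Qed.

(** If [D] is not in [N], let [K] be maximal among the submodules between [N]
    and [D] other than [D]. For [a] in [m] and [x] in [D], if [a x] were outside
    [K], then [K + R a x] would be [D], so [(1 - r a) x] would be in [K] for some
    [r], and so would [x], as [1 - r a] is a unit. *)
Lemma nakayama q N D : q `<=` m -> submodule N -> submodule D ->
  D `<=` sumset N (smul q D) -> N `<=` D -> D `<=` N.
Proof.
move=> qm sN sD DNq ND; apply: contrapT => nDN.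
pose P K := [/\ submodule K, N `<=` K, K `<=` D & ~ D `<=` K].
have [K [sK NK KD nDK] Kmax] : exists2 K, P K &
    forall L, P L -> K `<=` L -> L `<=` K.
  by apply: maximal_submodule => //; [move=> K [] | exists N; split].
suff qDK : smul q D `<=` K by apply: nDK => x /DNq; apply: sumset_subset.
apply: smul_subset => // a x qa Dx; apply: contrapT => nKax.
have sL : submodule (sumset K (line (a *: x))).
  by apply: submodule_sumset => //; apply: submodule_line.
have KL : K `<=` sumset K (line (a *: x)).
  by apply: sumset_subl; apply: submodule_line.
have DL : D `<=` sumset K (line (a *: x)).
  apply: contrapT => nDL; apply: nKax; apply: (Kmax _ _ KL).
    split=> //; first exact: subset_trans KL.
    by apply: sumset_subset => //; apply: line_subset => //; apply: submoduleZ.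
  by apply: sumset_subr => //; apply: line_id.
have [k [_ [Kk [r _ <-] x_eq]]] := DL x Dx.
have [b b1] := local_unit (@local_1N a r (qm _ qa)).
apply: nKax; apply: submoduleZ => //.
have -> : x = b *: k.
  rewrite -[LHS]scale1r -b1 -scalerA; congr (_ *: _).
  by rewrite scalerBl scale1r {1}x_eq scalerA addrK.
exact: submoduleZ.
Qed.

(** Take [x] outside [K] with [(K : x)] maximal. If [a x] were outside [K], then
    [(K : a x)] would equal [(K : x)], and no power of [a] would bring [x] into
    [K]. *)
Lemma exists_socle (I : set R) K : submodule K -> K <> setT ->
  (forall a x, I a -> exists j, K (a ^+ j *: x)) ->
  exists2 x, ~ K x & forall a, I a -> K (a *: x).
Proof.
move=> sK KT nil.
have [x0 nKx0] : exists x, ~ K x.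
  by apply/existsNP => KV; apply: KT; apply/seteqP; split.
pose P (J : set R^o) := exists2 x, ~ K x & J = [set r : R | K (r *: x)].
have [J [x nKx J_eq] Jmax] : exists2 J, P J &
    forall I, P I -> J `<=` I -> I `<=` J.
  apply: maximal_submodule => //; last by exists [set r : R | K (r *: x0)], x0.
  move=> _ [x _ ->]; split=> [|a r r' Kr Kr'].
    by rewrite /= scale0r; apply: submodule0.
  by rewrite /= scalerDl -scalerA; case: sK => _; apply.
exists x => // a Ia; apply: contrapT => nKax.
have shift r : K (r *: (a *: x)) -> K (r *: x).
  move=> Krax; have : J r; last by rewrite J_eq.
  apply: (Jmax [set r : R | K (r *: (a *: x))]) => //; first by exists (a *: x).
  move=> c; rewrite J_eq /= => Kcx.
  by rewrite scalerA mulrC -scalerA; apply: submoduleZ.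
have [j] := nil a x Ia; elim: j => [|j IH]; first by rewrite scale1r.
by rewrite exprSr -scalerA => /shift.
Qed.

Section Filtered.
Variables (q : set R) (F : nat -> set V).
Hypothesis gF : good_filtration q F.

Lemma filtration_submodule n : submodule (F n).
Proof. by case: gF => -[]. Qed.

Lemma filtration_le i j : (i <= j)%N -> F j `<=` F i.
Proof.
elim: j => [|j IH]; first by rewrite leqn0 => /eqP->.
rewrite leq_eqVlt => /orP[/eqP->//|/IH]; apply: subset_trans.
by case: gF => -[].
Qed.

Lemma filtration_mul a n x : q a -> F n x -> F n.+1 (a *: x).
Proof. by move=> qa Fx; case: gF => -[_ _ _ qF] _; apply: qF; apply: smul_in. Qed.

Lemma filtration_exp a n k x : q a -> F n x -> F (n + k)%N (a ^+ k *: x).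
Proof.
move=> qa Fx; elim: k => [|k IH]; first by rewrite scale1r addn0.
by rewrite exprS -scalerA addnS; apply: filtration_mul.
Qed.

Lemma filtration_exp0 a k x : q a -> F k (a ^+ k *: x).
Proof.
by move=> qa; apply: (@filtration_exp a 0) => //; case: gF => -[->].
Qed.

(** A maximal counterexample [N] would have an [x] outside [N] with
    [q x] in [N]; as [F n] is in [N + R x] for some [n], [F n.+1 = q F n] would
    be in [N]. *)
Lemma filtration_subset_nilpotent K : submodule K ->
  (forall a x, q a -> exists j, K (a ^+ j *: x)) -> exists n, F n `<=` K.
Proof.
move=> sK nil; apply: contrapT => nFK.
pose P N := [/\ submodule N, K `<=` N & ~ exists n, F n `<=` N].
have [N [sN KN nFN] Nmax] : exists2 N, P N &
    forall L, P L -> N `<=` L -> L `<=` N.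
  by apply: maximal_submodule => //; [move=> N [] | exists K; split].
have [x nNx qx] : exists2 x, ~ N x & forall a, q a -> N (a *: x).
  apply: exists_socle => //; first by move=> NT; apply: nFN; exists 0%N; rewrite NT.
  by move=> a x qa; have [j Kj] := nil a x qa; exists j; apply: KN.
have NL : N `<=` sumset N (line x) by apply: sumset_subl; apply: submodule_line.
have [n FL] : exists n, F n `<=` sumset N (line x).
  apply: contrapT => nFL; apply: nNx; apply: (Nmax (sumset N (line x))) => //.
    split=> //; last exact: subset_trans NL.
    by apply: submodule_sumset => //; apply: submodule_line.
  by apply: sumset_subr => //; apply: line_id.
have [_ [n0 good]] := gF.
apply: nFN; exists (maxn n n0).+1; rewrite -good ?leq_maxr//.
apply: smul_subset => // a y qa Fy.
have [u [_ [Nu [r _ <-] ->]]] := FL y (filtration_le (leq_maxl _ _) Fy).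
rewrite scalerDr; apply: submoduleD => //; first exact: submoduleZ.
by rewrite scalerA mulrC -scalerA; apply: submoduleZ => //; apply: qx.
Qed.

(** Let [K] be maximal with [K `&` D = D']. For [a] in [q], the chain
    [(K : a ^+ i)] stops growing at some [i]. An element [k + a ^+ i v] of [D]
    with [k] in [K] is brought into [D'] by some power of [a]; so [a ^+ i v] is
    brought into [K] by that power, hence is in [K] already. This makes
    [(K + a ^+ i V) `&` D = D'], so [a ^+ i V] is in [K] by maximality. *)
Lemma artin_rees D D' : submodule D -> submodule D' -> D' `<=` D ->
  (forall a, q a -> exists j, forall x, D x -> D' (a ^+ j *: x)) ->
  exists n, F n `&` D `<=` D'.
Proof.
move=> sD sD' D'D nil.
pose P K := [/\ submodule K, D' `<=` K & K `&` D `<=` D'].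
have [K [sK D'K KD] Kmax] : exists2 K, P K &
    forall L, P L -> K `<=` L -> L `<=` K.
  by apply: maximal_submodule => //; [move=> K [] | exists D'; split=> // x []].
suff [n FK] : exists n, F n `<=` K.
  by exists n => x [Fx Dx]; apply: KD; split=> //; apply: FK.
apply: filtration_subset_nilpotent => // a x qa.
have [_ [i ->] imax] : exists2 N, (exists i, N = [set x | K (a ^+ i *: x)]) &
    forall L, (exists i, L = [set x | K (a ^+ i *: x)]) -> N `<=` L -> L `<=` N.
  apply: maximal_submodule => //; last by exists [set x | K (a ^+ 0 *: x)], 0%N.
  move=> _ [i ->].
  by have := submodule_colon [set a ^+ i] sK; rewrite colon1E.
have stable j y : K (a ^+ j *: (a ^+ i *: y)) -> K (a ^+ i *: y).
  move=> Ky; apply: (imax [set x | K (a ^+ (i + j) *: x)]).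
  - by exists (i + j)%N.
  - by move=> z Kz; rewrite /= exprD mulrC -scalerA; apply: submoduleZ.
  - by rewrite /= exprD mulrC -scalerA.
have sL : submodule (sumset K (scaleset (a ^+ i) setT)).
  by apply: submodule_sumset => //; apply: submodule_scaleset.
have KL : K `<=` sumset K (scaleset (a ^+ i) setT).
  by apply: sumset_subl; apply: submodule_scaleset.
exists i; apply: (Kmax _ _ KL); last by apply: sumset_subr => //; exists x.
split=> //; first exact: subset_trans KL.
move=> _ [[k [_ [Kk [v _ <-] ->]]] Dkv].
have [j Dj] := nil a qa; apply: (KD); split=> //.
apply: submoduleD => //; apply: (stable j).
have := D'K _ (Dj _ Dkv); rewrite scalerDr => Kkv.
rewrite -[_ *: _](addKr (a ^+ j *: k)) addrC.
by apply: submoduleB => //; apply: submoduleZ.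
Qed.

(** The closure [D] of [A] satisfies [D = A + q D] by Artin-Rees, so that
    Nakayama applies. *)
Lemma krull_closed A x : q `<=` m -> submodule A ->
  (forall n, sumset (F n) A x) -> A x.
Proof.
move=> qm sA clx; pose D := \bigcap_n sumset (F n) A.
have sF := filtration_submodule.
have sD : submodule D.
  have sFA n : submodule (sumset (F n) A) by apply: submodule_sumset.
  split=> [n _|a u v Du Dv n _]; have [FA0 FAD] := sFA n => //.
  by apply: FAD; [apply: Du | apply: Dv].
have AD : A `<=` D by move=> y Ay n _; apply: sumset_subr.
have sqD := submodule_smul q D.
have [n Fn] : exists n, F n `&` D `<=` sumset A (smul q D).
  apply: (artin_rees sD) => [||a qa].
  - exact: submodule_sumset.
  - apply: sumset_subset => //; apply: smul_subset => // a y _.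
    exact: submoduleZ.
  - by exists 1%N => y Dy; apply: sumset_subr => //; apply: smul_in.
suff DA : D `<=` A by apply: DA => n' _.
apply: (nakayama qm sA sD) => // y Dy.
have [f [u [Fnf Au y_eq]]] := Dy n I.
have sAD : submodule (sumset A (smul q D)) by apply: submodule_sumset.
rewrite y_eq; apply: submoduleD => //; last by apply: sumset_subl.
apply: Fn; split=> //; rewrite -[f](addrK u) -y_eq.
by apply: (submoduleB sD) => //; apply: AD.
Qed.

End Filtered.
End LocalAlgebra.

(** * Length of an interval of submodules *)

Lemma supremum_nat_mem (A : set nat) k b :
  A k -> (forall i, A i -> (i <= b)%N) -> A (supremum 0%N A).
Proof.
move=> Ak Ab; have [s [ubs lbs]] : supremums A !=set0.
  by apply: nat_supremums_neq0; exists b => i /Ab.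
rewrite /supremum; case: ifPn => [/eqP A0|_]; first by rewrite A0 in Ak.
case: xgetP => [{ubs lbs}t _ [ubt lbt]|/(_ s)]; last by case.
apply: contrapT => nAt.
case: t => [|t] in ubt lbt nAt *.
  by have := ubt _ Ak; rewrite leEnat leqn0 => /eqP k0; rewrite k0 in Ak.
suff /lbt : ubound A t by rewrite leEnat ltnn.
move=> i Ai; have := ubt _ Ai; rewrite !leEnat leq_eqVlt => /orP[/eqP it|//].
by rewrite it in Ai.
Qed.

Lemma supremum_nat_ge (A : set nat) k b :
  A k -> (forall i, A i -> (i <= b)%N) -> (k <= supremum 0%N A)%N.
Proof.
move=> Ak Ab; rewrite -leEnat; apply: ge_supremum_Nmem => //.
by apply: nat_supremums_neq0; exists b => i /Ab.
Qed.

Section Length.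
Variables (R : comNzRingType) (V : lmodType R).
Implicit Types (N L K C D A B : set V).

Definition interval N L : set (set V) :=
  [set C | [/\ submodule C, N `<=` C & C `<=` L]].

Definition has_chain N L k : Prop :=
  exists C : nat -> set V,
    (forall i, (i <= k)%N -> interval N L (C i)) /\ strict_chain C k.

Definition finite_length N L : Prop :=
  exists b, forall k, has_chain N L k -> (k <= b)%N.

(** The length of [L / N], computed among the submodules of [V]; quotients of
    [V] by different submodules can then be compared without leaving [V]. *)
Definition len N L : nat := supremum 0%N [set k | has_chain N L k].

Lemma has_chain0 N L : submodule N -> N `<=` L -> has_chain N L 0.
Proof. by move=> sN NL; exists (fun=> N); split=> // i _; split. Qed.

Lemma has_chain_len N L :
  submodule N -> N `<=` L -> finite_length N L -> has_chain N L (len N L).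
Proof.
move=> sN NL [b bP]; apply: (@supremum_nat_mem [set k | has_chain N L k]) bP.
exact: has_chain0.
Qed.

Lemma has_chain_le N L k : finite_length N L -> has_chain N L k -> (k <= len N L)%N.
Proof.
by move=> [b bP] NLk; apply: (@supremum_nat_ge [set k | has_chain N L k]) bP.
Qed.

Lemma len_le N L b : submodule N -> N `<=` L ->
  (forall k, has_chain N L k -> (k <= b)%N) -> (len N L <= b)%N.
Proof. by move=> sN NL bP; apply/bP/has_chain_len => //; exists b. Qed.

Lemma has_chainW N N' L L' k :
  N' `<=` N -> L `<=` L' -> has_chain N L k -> has_chain N' L' k.
Proof.
move=> NN LL [C [CP Cs]]; exists C; split=> // i /CP[sC NC CL].
by split=> //; [apply: subset_trans NC | apply: subset_trans LL].
Qed.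

Lemma finite_lengthW N N' L L' :
  N `<=` N' -> L' `<=` L -> finite_length N L -> finite_length N' L'.
Proof. by move=> NN LL [b bP]; exists b => k /(has_chainW NN LL)/bP. Qed.

Lemma has_chainS N L L' k : has_chain N L k ->
  submodule L' -> N `<=` L' -> L `<` L' -> has_chain N L' k.+1.
Proof.
move=> [C [CP Cs]] sL' NL' [LL' nL'L].
exists (fun i => if (i <= k)%N then C i else L'); split=> i ik.
  by case: ifPn => [/CP[sC NC CL]|_]; split=> //; apply: subset_trans LL'.
move: ik; rewrite ltnS => ik; rewrite ik.
case: (ltnP i k) => [|ki]; first exact: Cs.
have [_ _ CL] := CP i ik.
by split; [apply: subset_trans LL' | move=> /subset_trans/(_ CL)].
Qed.

Lemma has_chain_cat N K L p r :
  has_chain N K p -> has_chain K L r -> has_chain N L (p + r).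
Proof.
move=> cN [C [CP Cs]].
have NK : N `<=` K.
  by case: cN => D [/(_ 0%N isT)[_ ND DK] _]; apply: subset_trans DK.
have step i : (i <= r)%N -> has_chain N (C i) (p + i).
  elim: i => [_|i IH ir].
    by rewrite addn0; apply: has_chainW cN => //; have [] := CP 0%N isT.
  rewrite addnS; have [sC KC _] := CP _ ir.
  apply: (has_chainS (IH (ltnW ir))) => //; first exact: subset_trans KC.
  exact: Cs.
by apply: has_chainW (step r (leqnn _)) => //; have [] := CP r (leqnn r).
Qed.

(** By the modular law, each strict step of a chain stays strict in its trace
    on [K] or in its sum with [K]. *)
Lemma has_chain_split N K L k : submodule N -> submodule K ->
  N `<=` K -> K `<=` L -> submodule L -> has_chain N L k ->
  exists p r, [/\ has_chain N K p, has_chain K L r & (k <= p + r)%N].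
Proof.
move=> sN sK NK KL sL [C [CP Cs]].
have step i : (i <= k)%N -> exists p r,
    [/\ has_chain N (C i `&` K) p, has_chain K (sumset (C i) K) r & (i <= p + r)%N].
  elim: i => [_|i IH ik].
    have [sC NC _] := CP 0%N isT; exists 0%N, 0%N; split=> //.
      by apply: has_chain0 => // x Nx; split; [apply: NC | apply: NK].
    by apply: has_chain0 => //; apply: sumset_subr.
  have [p [r [cp cr ipr]]] := IH (ltnW ik).
  have [sC NC _] := CP _ (ltnW ik); have [sC' NC' _] := CP _ ik.
  have [CC' nC'C] := Cs i ik.
  have [IK|nIK] := pselect (C i.+1 `&` K `<=` C i `&` K).
    exists p, r.+1; split; last by rewrite addnS ltnS.
      apply: has_chainW cp => // x [Cx Kx]; split=> //; exact: CC'.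
    apply: (has_chainS cr); first exact: submodule_sumset.
      exact: sumset_subr.
    split; first exact: sumsetS.
    move=> SK; apply: nC'C => x Cx.
    have [c [y [Cc Ky x_eq]]] := SK x (sumset_subl sK Cx).
    have [] : (C i `&` K) y; last by rewrite x_eq => ? _; apply: submoduleD.
    apply: IK; split=> //; rewrite -[y](addKr c) addrC -x_eq.
    by apply: submoduleB => //; apply: CC'.
  exists p.+1, r; split; last by rewrite addSn ltnS.
    apply: (has_chainS cp); first exact: submodule_setI.
      by move=> x Nx; split; [apply: NC' | apply: NK].
    by split=> // x [Cx Kx]; split=> //; apply: CC'.
  by apply: has_chainW cr => //; apply: sumsetS.
have [p [r [cp cr kpr]]] := step k (leqnn k).
exists p, r; split=> //; first by apply: has_chainW cp => // x [].
apply: has_chainW cr => //; apply: sumset_subset => //.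
by have [] := CP k (leqnn k).
Qed.

Lemma finite_length_cat N K L : submodule N -> submodule K -> submodule L ->
  N `<=` K -> K `<=` L ->
  finite_length N K -> finite_length K L -> finite_length N L.
Proof.
move=> sN sK sL NK KL [b bP] [c cP]; exists (b + c)%N => k.
move=> /(has_chain_split sN sK NK KL sL)[p [r [/bP pb /cP rc kpr]]].
exact: leq_trans kpr (leq_add pb rc).
Qed.

Lemma lenD N K L : submodule N -> submodule K -> submodule L ->
  N `<=` K -> K `<=` L -> finite_length N L -> len N L = (len N K + len K L)%N.
Proof.
move=> sN sK sL NK KL fNL.
have fNK : finite_length N K by apply: finite_lengthW fNL.
have fKL : finite_length K L by apply: finite_lengthW fNL.
have NL := subset_trans NK KL.
apply/eqP; rewrite eqn_leq; apply/andP; split.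
  have cNL := has_chain_len sN NL fNL.
  have [p [r [cp cr kpr]]] := has_chain_split sN sK NK KL sL cNL.
  by apply: leq_trans kpr (leq_add _ _); apply: has_chain_le.
by apply: has_chain_le => //; apply: has_chain_cat; apply: has_chain_len.
Qed.

End Length.

Lemma has_chain_map (R : comNzRingType) (V V' : lmodType R) (N L : set V)
    (N' L' : set V') (f : set V -> set V') k :
  (forall C, interval N L C -> interval N' L' (f C)) ->
  (forall C D, interval N L C -> interval N L D -> C `<` D -> f C `<` f D) ->
  has_chain N L k -> has_chain N' L' k.
Proof.
move=> fI fS [C [CP Cs]]; exists (f \o C); split=> i ik; first by apply/fI/CP.
by apply: fS; [apply/CP/ltnW | apply/CP | apply: Cs].
Qed.

Lemma len_has_chain (R : comNzRingType) (V V' : lmodType R) (N L : set V)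
    (N' L' : set V') :
  (forall k, has_chain N L k <-> has_chain N' L' k) -> len N L = len N' L'.
Proof. by move=> H; congr supremum; apply/seteqP; split=> k /H. Qed.

Section LengthTheory.
Local Open Scope quotient_scope.
Variables (R : comNzRingType) (V : lmodType R).
Implicit Types (N L K C D A B : set V).

(** The correspondence between submodules of [L / N] and submodules between [N]
    and [L]. *)
Lemma length_quotE N L :
  submodule N -> submodule L -> N `<=` L -> length_quot L N = len N L.
Proof.
move=> sN sL NL.
have pi0 : \pi_(quotmod N) 0 = 0.
  by apply: (addrI (\pi_(quotmod N) 0)); rewrite -piD !addr0.
have piE C x : submodule C -> N `<=` C ->
    quot_image N C (\pi_(quotmod N) x) <-> C x.
  move=> sC NC; split=> [[y Cy /quotmodP]|Cx]; last by exists x.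
  rewrite span_submodule // => /NC Cyx; rewrite -[x](subKr y).
  exact: submoduleB.
have piS C : submodule C -> submodule (quot_image N C).
  move=> sC; split=> [|a _ _ [x Cx <-] [y Cy <-]].
    by exists 0; [apply: submodule0 | rewrite pi0].
  exists (a *: x + y); first by case: sC => _; apply.
  by rewrite piD -pi_scaleq.
transitivity (len [set 0] (quot_image N L)).
  congr supremum; apply/seteqP; split=> k [C [CP Cs]]; exists C; split=> // i.
    by move=> /CP[sC CL]; split=> // _ ->; apply: submodule0.
  by move=> /CP[sC _ CL].
apply: len_has_chain => k; split.
  apply: (has_chain_map (f := fun E : set (quotmod N) => [set x | E (\pi x)])).
    move=> E [[E0 sE] _ EL]; split.
    - split=> [|a x y Ex Ey]; first by rewrite /= pi0.
      by rewrite /= piD -pi_scaleq; apply: sE.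
    - move=> x Nx; rewrite /= (_ : \pi_(quotmod N) x = 0); first exact: E0.
      by rewrite -pi0; apply/quotmodP; rewrite subr0 span_submodule.
    - by move=> x /EL /piE; apply.
  move=> E E' _ _ [EE' nE'E]; split=> [x /EE' //|E'E].
  by apply: nE'E => x; rewrite -[x]reprK; apply: E'E.
apply: (has_chain_map (f := quot_image N)).
  move=> C [sC NC CL]; split; first exact: piS.
    by move=> _ ->; apply: submodule0; apply: piS.
  by move=> _ [x Cx <-]; exists x => //; apply: CL.
move=> C D [sC NC _] [sD ND _] [CD nDC]; split.
  by move=> _ [x Cx <-]; exists x => //; apply: CD.
by move=> DC; apply: nDC => x Dx; apply/(piE _ _ sC NC)/DC; apply/piE.
Qed.

(** Multiplication by [a] induces an isomorphism from [V / (K : a)] to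
    [(a V + K) / K]. *)
Lemma len_colon K a : submodule K ->
  len K (sumset (scaleset a setT) K) = len (colon K [set a]) setT.
Proof.
move=> sK; rewrite colon1E; apply: len_has_chain => k; split.
  apply: (@has_chain_map _ _ _ _ _ _ _ (fun C => [set x | C (a *: x)])).
    move=> C [sC KC _]; split=> //; last by move=> x; apply: KC.
    by have := submodule_colon [set a] sC; rewrite colon1E.
  move=> C D [sC KC _] [sD KD DL] [CD nDC]; split=> [x /CD //|DC].
  apply: nDC => d Dd; have [_ [y [[v _ <-] Ky d_eq]]] := DL _ Dd.
  rewrite d_eq; apply: submoduleD => //; last exact: KC.
  apply: (DC v); rewrite /= -[_ *: _](addrK y) -d_eq.
  by apply: submoduleB => //; apply: KD.
apply: (@has_chain_map _ _ _ _ _ _ _ (fun D => sumset (scaleset a D) K)).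
  move=> D [sD KD _]; have saD := submodule_scaleset a sD; split.
  - exact: submodule_sumset.
  - exact: sumset_subr.
  - by apply: sumsetS => // _ [x _ <-]; exists x.
move=> C D [sC KC _] [sD KD _] [CD nDC]; split.
  by apply: sumsetS => // _ [x Cx <-]; exists x => //; apply: CD.
move=> DC; apply: nDC => x Dx.
have [_ [y [[c Cc <-] Ky ax_eq]]] : sumset (scaleset a C) K (a *: x).
  by apply: DC; apply: sumset_subl => //; exists x.
rewrite -[x](subrK c); apply: submoduleD => //; apply: KC.
by rewrite /= scalerBr ax_eq addrC addKr.
Qed.

(** [(K + B) / K] is a quotient of [B / A]. *)
Lemma len_sumset_le K A B : submodule K -> submodule A -> submodule B ->
  A `<=` K -> A `<=` B -> finite_length A B -> (len K (sumset K B) <= len A B)%N.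
Proof.
move=> sK sA sB AK AB fAB; apply: len_le => //; first exact: sumset_subl.
move=> k cK; apply: has_chain_le => //; move: cK.
apply: (has_chain_map (f := fun C => C `&` B)).
  move=> C [sC KC _]; split; first exact: submodule_setI.
    by move=> x Ax; split; [apply/KC/AK | apply: AB].
  by move=> x [].
move=> C D [sC KC _] [sD KD DL] [CD nDC]; split.
  by move=> x [/CD].
move=> DC; apply: nDC => d Dd; have [y [b [Ky Bb d_eq]]] := DL _ Dd.
have [|Cb _] := DC b.
  split=> //; rewrite -[b](addKr y) -d_eq addrC.
  by apply: submoduleB => //; apply: KD.
by rewrite d_eq; apply: submoduleD => //; apply: KC.
Qed.

(** [B / A] embeds into [V / L]. *)
Lemma finite_length_embed A B L : submodule L ->
  B `&` L `<=` A -> finite_length L setT -> finite_length A B.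
Proof.
move=> sL BLA [b bP]; exists b => k cA; apply: bP; move: cA.
apply: (has_chain_map (f := fun C => sumset C L)).
  move=> C [sC AC _]; split=> //; first exact: submodule_sumset.
  exact: sumset_subr.
move=> C D [sC AC CB] [sD AD DB] [CD nDC]; split; first exact: sumsetS.
move=> DC; apply: nDC => d Dd.
have [c [y [Cc Ly d_eq]]] := DC d (sumset_subl sL Dd).
rewrite d_eq; apply: submoduleD => //; apply/AC/BLA; split=> //; apply: DB.
rewrite -[y](addKr c) -d_eq addrC.
by apply: submoduleB => //; apply: CD.
Qed.

(** If [r x] is outside [N], then [r] is a unit: [(N + R x) / N] is zero or the
    residue field. *)
Lemma simple_interval m N x k : noetherian R -> local_ring m ->
  submodule N -> (forall a, m a -> N (a *: x)) ->
  has_chain N (sumset N (line x)) k -> (k <= 1)%N.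
Proof.
move=> nR locR sN mx [C [CP Cs]]; rewrite leqNgt; apply/negP => k2.
have [sC0 NC0 _] := CP 0%N isT.
have [sC1 NC1 C1L] := CP 1%N (ltnW k2).
have [_ _ C2L] := CP 2%N k2.
have [_ nC1] := Cs 0%N (ltnW k2); have [_ nC2] := Cs 1%N k2.
have C1N : ~ C 1%N `<=` N by move=> /subset_trans/(_ NC0).
have [c [Cc nNc]] : exists c, C 1%N c /\ ~ N c.
  apply: contrapT => nc; apply: C1N => c Cc; apply: contrapT => nNc.
  by apply: nc; exists c.
have [y [_ [Ny [r _ <-] c_eq]]] := C1L c Cc.
have nNrx : ~ N (r *: x).
  by move=> Nrx; apply: nNc; rewrite c_eq; apply: submoduleD.
have [b br] := local_unit nR locR (fun mr => nNrx (mx _ mr)).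
apply: nC2; apply: subset_trans C2L _; apply: sumset_subset => //.
apply: line_subset => //; rewrite -[x]scale1r -br -scalerA.
apply: submoduleZ => //; rewrite -[_ *: _](addKr y) -c_eq addrC.
by apply: submoduleB => //; apply: NC1.
Qed.

(** A maximal [N] containing [K] with [N / K] of finite length is the whole
    module: otherwise some [x] outside [N] is killed by [m] modulo [N], and
    [N + R x] would do as well. *)
Lemma finite_length_nilpotent m K : noetherian R -> local_ring m ->
  noetherian_module V -> submodule K ->
  (forall a x, m a -> exists j, K (a ^+ j *: x)) -> finite_length K setT.
Proof.
move=> nR locR nV sK nil.
pose P N := [/\ submodule N, K `<=` N & finite_length K N].
have [N [sN KN fN] Nmax] : exists2 N, P N &
    forall L, P L -> N `<=` L -> L `<=` N.
  apply: maximal_submodule => //; first by move=> N [].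
  exists K; split=> //; exists 0%N => -[//|k] [C [CP Cs]].
  have [_ KC _] := CP 0%N isT; have [_ _ CK] := CP 1%N isT.
  by have [_ []] := Cs 0%N isT; apply: subset_trans KC.
have [<-//|NT] := pselect (N = setT).
have [x nNx mx] : exists2 x, ~ N x & forall a, m a -> N (a *: x).
  apply: exists_socle => // a x ma.
  by have [j Kj] := nil a x ma; exists j; apply: KN.
have NL : N `<=` sumset N (line x) by apply: sumset_subl; apply: submodule_line.
have sL : submodule (sumset N (line x)).
  by apply: submodule_sumset => //; apply: submodule_line.
case: nNx; apply: (Nmax _ _ NL); last by apply: sumset_subr => //; apply: line_id.
split=> //; first exact: subset_trans NL.
apply: (finite_length_cat sK sN sL) => //.
by exists 1%N => k; apply: (simple_interval nR locR).
Qed.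

End LengthTheory.

(** * Superficial elements *)

Lemma primary_sub (R : comNzRingType) (m q : set R) :
  primary_ideal m q -> q `<=` m.
Proof. by move=> [_ _ _ <-] a qa; exists 1%N. Qed.

Lemma smul_ideal_gen1 (R : comNzRingType) (V : lmodType R) (a : R) :
  smul (ideal_gen [set a]) [set: V] = scaleset a setT.
Proof.
apply/seteqP; split; last first.
  move=> _ [x _ <-]; apply: smul_in => //.
  exact: (@subset_span R R^o [set a] a erefl).
apply: smul_subset; first exact: submodule_scaleset.
move=> b x ab _; suff [r ->] : exists r, b = r * a.
  by exists (r *: x); rewrite // scalerA mulrC.
move: b ab; apply: (@span_subset R R^o [set a] [set b | exists r, b = r * a]).
  split=> [|c _ _ [r ->] [r' ->]]; first by exists 0; rewrite mul0r.
  by exists (c * r + r'); rewrite mulrDl -mulrA.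
by move=> _ ->; exists 1; rewrite mul1r.
Qed.

Lemma prefix_mul0 (R : comNzRingType) (V : lmodType R) (s : seq R) :
  prefix_mul V s 0 = [set 0].
Proof.
have s0 := @submodule_set0 R V.
apply/seteqP; split; last by move=> _ ->; apply: submodule0; apply: submodule_smul.
apply: smul_subset => // b x gb _ /=.
suff -> : b = 0 by rewrite scale0r.
move: b gb; apply: (@span_subset R R^o _ [set 0]); first exact: (@submodule_set0 R R^o).
by rewrite take0 => b.
Qed.

Lemma quot_imageE (R : comNzRingType) (V : lmodType R) (N L : set V) x :
  submodule N -> quot_image N L (\pi_(quotmod N)%qT x) <-> sumset L N x.
Proof.
move=> sN; split=> [[y Ly /quotmodP]|[y [z [Ly Nz ->]]]].
  rewrite span_submodule // => Nyx; exists y, (x - y); split=> //.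
    by rewrite -opprB -scaleN1r; apply: submoduleZ.
  by rewrite addrC subrK.
exists y => //; apply/quotmodP; rewrite span_submodule // opprD addrA subrr sub0r.
by rewrite -scaleN1r; apply: submoduleZ.
Qed.

(** What superficiality for [F / A] provides, expressed in the module [V]. *)
Definition superficial_mod (R : comNzRingType) (V : lmodType R)
    (F : nat -> set V) (A : set V) (a : R) c : Prop :=
  forall n x, (c <= n)%N ->
    sumset (F n.+1) A (a *: x) -> sumset (F c) A x -> sumset (F n) A x.

Lemma superficial_modP (R : comNzRingType) (V : lmodType R) (q : set R)
    (F : nat -> set V) (A : set V) a : submodule A ->
  superficial q (quot_filtration A F) a ->
  q a /\ exists c, superficial_mod F A a c.
Proof.
move=> sA [qa [c cP]]; split=> //; exists c => n x cn Fax Fcx.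
apply/(quot_imageE _ _ sA); rewrite -/(quot_filtration A F n) -(cP n cn).
split; last exact/quot_imageE.
by move=> _ ->; rewrite [_ *: _]pi_scaleq; apply/quot_imageE.
Qed.

Lemma depth_gt0_regular (R : comNzRingType) (V : lmodType R) (m : set R) :
  (0 < depth V m)%N -> exists2 r, m r & forall x : V, r *: x = 0 -> x = 0.
Proof.
move=> d0; apply: contrapT => nreg.
pose S := [set k | exists s : seq R,
  [/\ size s = k, [set` s] `<=` m & regular_sequence V s]].
have S0 k : S k -> k = 0%N.
  move=> [[|r s] [<- // sm [reg _]]]; case: nreg; exists r.
    by apply: sm; rewrite /= mem_head.
  move=> x rx0; have := reg 0%N isT (\pi_(quotmod _)%qT x).
  rewrite [_ *: _]pi_scaleq rx0 prefix_mul0.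
  have pi0 : \pi_(quotmod [set 0])%qT 0 = 0 :> quotmod [set (0 : V)].
    by apply: (addrI (\pi_(quotmod [set 0])%qT (0 : V))); rewrite -piD !addr0.
  rewrite -{2}pi0 => /(_ pi0) /quotmodP.
  by rewrite span_submodule ?subr0 //; apply: submodule_set0.
suff : depth V m = 0%N by move: d0 => /[swap] ->.
have [[k Sk]|nS] := pselect (exists k, S k).
  by apply: (S0); apply: (@supremum_nat_mem S k 0) => // i /S0 ->.
rewrite /depth (_ : [set k | _] = set0) ?supremum0 //.
by apply/seteqP; split=> // k Sk; case: nS; exists k.
Qed.

Section Superficial.
Variables (R : comNzRingType) (m q : set R) (V : lmodType R).
Variables (F : nat -> set V).
Hypotheses (nR : noetherian R) (locR : local_ring m).
Hypothesis nV : noetherian_module V.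
Hypothesis qm : primary_ideal m q.
Hypothesis gF : good_filtration q F.
Implicit Types (A B : set V) (a : R).

(** Superficiality pushes an element of the left-hand side into [F n + A] for
    every [n]. *)
Lemma superficial_torsion A a c : submodule A -> superficial_mod F A a c ->
  colon A [set a] `&` sumset (F c) A `<=` A.
Proof.
move=> sA sup x [/= aA Fcx].
apply: (krull_closed nR locR nV gF (primary_sub qm) sA) => n.
have sF := filtration_submodule gF.
suff : sumset (F (maxn c n)) A x.
  by apply: sumsetS => //; apply: (filtration_le gF); apply: leq_maxr.
apply: sup => //; first exact: leq_maxl.
by apply: sumset_subr => //; apply: aA.
Qed.

(** By Artin-Rees, [F n `&` (a V + A)] is in [a F c + A] for some [n], which
    brings the elements to which superficiality applies into [F c + A]. *)
Lemma superficial_colon A a c : submodule A -> superficial_mod F A a c -> q a ->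
  exists n0, forall n x, (n0 <= n)%N ->
    sumset (F n.+1) A (a *: x) -> sumset (F n) (colon A [set a]) x.
Proof.
move=> sA sup qa; have sF := filtration_submodule gF.
have sa N : submodule N -> submodule (sumset (scaleset a N) A).
  by move=> sN; apply: submodule_sumset => //; apply: submodule_scaleset.
have [n Fn] : exists n, F n `&` sumset (scaleset a setT) A `<=`
    sumset (scaleset a (F c)) A.
  apply: (artin_rees nR nV gF) => [|||b qb]; [exact: sa | exact: sa | |].
    by apply: sumsetS => // _ [x _ <-]; exists x.
  exists c => _ [_ [u [[x _ <-] Au ->]]]; rewrite scalerDr.
  exists (a *: (b ^+ c *: x)), (b ^+ c *: u); split=> //.
    by exists (b ^+ c *: x) => //; apply: (filtration_exp0 gF).
    exact: submoduleZ.
  by rewrite !scalerA mulrC.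
exists (maxn n c) => k x; rewrite geq_max => /andP[nk ck] [f [u [Ff Au ax_eq]]].
have Fnf : F n f by apply: (filtration_le gF) Ff; apply: leqW.
have [|_ [u' [[y Fy <-] Au' f_eq]]] := Fn f.
  split=> //; exists (a *: x), (- u); split; first by exists x.
    by rewrite -scaleN1r; apply: submoduleZ.
  by rewrite ax_eq addrK.
have [g [w [Fg Aw y_eq]]] : sumset (F k) A y.
  apply: sup => //; last exact: sumset_subl.
  exists f, (- u'); split=> //; last by rewrite f_eq addrK.
  by rewrite -scaleN1r; apply: submoduleZ.
exists g, (x - g); split=> //; last by rewrite addrC subrK.
move=> _ ->; rewrite (_ : x - g = (x - y) + w); last first.
  by rewrite y_eq opprD addrA subrK.
rewrite scalerDr; apply: submoduleD => //; last exact: submoduleZ.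
rewrite scalerBr ax_eq f_eq -[X in X - _]addrA [X in X - _]addrC addrK.
exact: submoduleD.
Qed.

(** A power of [r] embeds the [a]-torsion of [V] into its part in [F c], which
    is zero. *)
Lemma superficial_regular r a c : m r -> (forall x : V, r *: x = 0 -> x = 0) ->
  superficial_mod F [set 0] a c -> forall x : V, a *: x = 0 -> x = 0.
Proof.
move=> mr reg sup x ax0.
have [_ _ _ rad] := qm; have [j qrj] : radical q r by rewrite rad.
have rreg i (y : V) : r ^+ i *: y = 0 -> y = 0.
  elim: i y => [|i IH] y; first by rewrite scale1r.
  by rewrite exprS -scalerA => /reg/IH.
apply: (rreg (j * c)%N); rewrite exprM.
apply: (superficial_torsion (@submodule_set0 R V) sup); split.
  by move=> _ -> /=; rewrite scalerA mulrC -scalerA ax0 scaler0.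
apply: sumset_subl; first exact: submodule_set0.
exact: (filtration_exp0 gF).
Qed.

Lemma regular_superficial_colon a c : (forall x : V, a *: x = 0 -> x = 0) ->
  superficial_mod F [set 0] a c -> q a ->
  exists n0, forall n x, (n0 <= n)%N -> F n.+1 (a *: x) -> F n x.
Proof.
move=> reg sup qa; have s0 := @submodule_set0 R V.
have [n0 n0P] := superficial_colon s0 sup qa.
exists n0 => n x n0n Fax; have [||f [u [Ff ua ->]]] := n0P n x => //.
  exact: sumset_subl.
by rewrite (reg u) ?addr0 //; apply: ua.
Qed.

(** ** The Ratliff-Rush filtration *)

Lemma ideal_exp_mul k i r x : ideal_exp q k r -> F i x -> F (i + k)%N (r *: x).
Proof.
have sF := filtration_submodule gF.
elim: k i r x => [|k IH] i r x; first by move=> _; rewrite addn0; apply: submoduleZ.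
move=> qr Fx; move: r qr.
apply: (@smul_subset R R^o q (ideal_exp q k)
  [set r | F (i + k.+1)%N (r *: x)]) => [|b y qb qy].
  split=> [|b u v Fu Fv]; first by rewrite /= scale0r; apply: submodule0.
  by rewrite /= scalerDl -scalerA; case: (sF (i + k.+1)%N) => _; apply.
rewrite /= -scalerA addnS; apply: (filtration_mul gF qb); exact: IH.
Qed.

Lemma ideal_exp_expr a k : q a -> ideal_exp q k (a ^+ k).
Proof.
move=> qa; elim: k => [//|k IH]; rewrite exprS.
by apply: (@smul_in R R^o q (ideal_exp q k) a (a ^+ k)).
Qed.

Lemma colon_cancel a n0 :
  (forall n x, (n0 <= n)%N -> F n.+1 (a *: x) -> F n x) ->
  forall j i x, (n0 <= i)%N -> F (i + j)%N (a ^+ j *: x) -> F i x.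
Proof.
move=> n0P; elim=> [|j IH] i x n0i; first by rewrite addn0 scale1r.
rewrite exprS -scalerA addnS => Fax; apply: IH => //; apply: n0P Fax.
exact: leq_trans n0i (leq_addr _ _).
Qed.

(** Multiplication by [a] can be undone from [n0] on, so the union that defines
    the Ratliff-Rush filtration is attained by the single power [a ^+ n0]. *)
Lemma ratliff_rushE a n0 : q a ->
  (forall n x, (n0 <= n)%N -> F n.+1 (a *: x) -> F n x) ->
  forall n x, ratliff_rush q F n x <-> F (n + n0)%N (a ^+ n0 *: x).
Proof.
move=> qa n0P n x; have cancel := colon_cancel n0P; split.
  move=> [k _ kP]; have Fkx := kP _ (ideal_exp_expr k qa).
  apply: (cancel k); first exact: leq_addl.
  rewrite scalerA mulrC -scalerA addnAC.
  exact: (filtration_exp gF).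
move=> Fx; exists n0.+1 => // r qr.
apply: (cancel n0); first by rewrite addnS leqW // leq_addl.
rewrite scalerA mulrC -scalerA addnAC; exact: ideal_exp_mul.
Qed.

End Superficial.

(** * Growth of the Hilbert function *)

Section Growth.
Variables (R : comNzRingType) (m q : set R) (V : lmodType R).
Variables (F E : nat -> set V) (a1 a2 : R).
Hypotheses (nR : noetherian R) (locR : local_ring m).
Hypothesis nV : noetherian_module V.
Hypothesis qm : primary_ideal m q.
Hypothesis gF : good_filtration q F.
Hypotheses (qa1 : q a1) (qa2 : q a2).
Hypothesis sE : forall n, submodule (E n).
Hypothesis E0 : E 0%N = setT.
Hypothesis E_le : forall n, E n.+1 `<=` E n.
Hypothesis qE : forall a n x, q a -> E n x -> E n.+1 (a *: x).

Lemma finite_length_colength n : finite_length (E n) setT.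
Proof.
apply: (finite_length_nilpotent nR locR nV (sE n)) => a x ma.
have [_ _ _ rad] := qm; have [j qaj] : radical q a by rewrite rad.
exists (j * n)%N; rewrite exprM; elim: n => [|n IH]; first by rewrite E0.
by rewrite exprS -scalerA; apply: qE.
Qed.

Let colen (K : set V) := len K setT.
Let A := scaleset a1 (@setT V).
Let L n := sumset (E n) A.

Hypothesis E_colon : forall n x, E n.+1 (a1 *: x) -> E n x.
Hypothesis E_stable : exists n0, forall n, (n0 <= n)%N -> E n = F n.
Variable c : nat.
Hypothesis sup : superficial_mod F A a2 c.

Let sA : submodule A. Proof. exact: submodule_scaleset. Qed.
Let sL n : submodule (L n). Proof. exact: submodule_sumset. Qed.
Let EL n : E n `<=` L n. Proof. exact: sumset_subl. Qed.

Lemma sumsetC (N K : set V) : sumset N K = sumset K N.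
Proof.
by apply/seteqP; split=> _ [u [v [Nu Kv ->]]]; exists v, u; rewrite addrC.
Qed.

Let fin K n : E n `<=` K -> finite_length K setT.
Proof.
by move=> EK; apply: finite_lengthW (finite_length_colength n).
Qed.

Let colenE n : colen (E n.+1) = (len (E n.+1) (E n) + colen (E n))%N.
Proof.
exact: (lenD (sE _) (sE _) (@submodule_setT _ V) _ _ (fin (n := n.+1) _)).
Qed.

(** [E n.+1 : a1 = E n] makes [(a1 V + E n.+1) / E n.+1] isomorphic to
    [V / E n], so passing to [V / a1 V] takes a difference of the lengths of the
    [V / E n]. *)
Let colenL n : colen (L n.+1) = len (E n.+1) (E n).
Proof.
have := lenD (sE n.+1) (sL n.+1) (@submodule_setT _ V) (@EL n.+1) (@subsetT _ _)
  (fin (n := n.+1) _).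
rewrite -/(colen _) colenE => /(_ (fun _ => id)).
rewrite /L sumsetC len_colon //.
have -> : colon (E n.+1) [set a1] = E n.
  rewrite colon1E; apply/seteqP; split=> x; first exact: E_colon.
  exact: qE.
by rewrite -/(colen _) addnC => /addnI.
Qed.

Let Q n := sumset (scaleset a2 setT) (L n).

Let colenQ n : colen (L n) = (colen (colon (L n) [set a2]) + colen (Q n))%N.
Proof.
have sQ : submodule (Q n) by apply: submodule_sumset => //; apply: submodule_scaleset.
rewrite /colen -len_colon //; apply: (lenD (sL n) sQ) => //.
  by apply: sumset_subr; apply: submodule_scaleset.
exact: (fin (n := n)).
Qed.

Let colonL n : L n `<=` colon (L n.+1) [set a2].
Proof.
rewrite colon1E => _ [u [_ [Eu [x _ <-] ->]]] /=.
rewrite scalerDr; exists (a2 *: u), (a2 *: (a1 *: x)); split=> //; first exact: qE.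
by apply: submoduleZ => //; exists x.
Qed.

Let colen_colon n :
  colen (L n) = (len (L n) (colon (L n.+1) [set a2]) +
                 colen (colon (L n.+1) [set a2]))%N.
Proof.
apply: (lenD _ _ _ (@colonL n)) => //; first exact: submodule_colon.
exact: (fin (n := n)).
Qed.

Let B := colon A [set a2].

(** For large [k], superficiality gives [(L k.+1 : a2) = L k + B], whose quotient
    by [L k] is a quotient of [B / A]. The latter has finite length, as [B] meets
    [F c + A] in [A]. *)
Let colonL_large : exists K, forall k, (K <= k)%N ->
  (len (L k) (colon (L k.+1) [set a2]) <= len A B)%N.
Proof.
have [n0 n0P] := E_stable.
have [n1 n1P] := superficial_colon nR nV gF sA sup qa2.
have sB : submodule B by apply: submodule_colon.
have AB : A `<=` B.
  by rewrite /B colon1E => x; apply: submoduleZ.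
exists (maxn n0 n1) => k; rewrite geq_max => /andP[k0 k1].
have -> : colon (L k.+1) [set a2] = sumset (L k) B.
  apply/seteqP; split.
    rewrite colon1E => x; rewrite /= /L n0P ?leqW // => /(n1P _ _ k1).
    by apply: sumsetS => //; rewrite -n0P //; apply: EL.
  apply: sumset_subset => //; first exact: submodule_colon.
  rewrite /B !colon1E => x /= Ax; exact: sumset_subr.
apply: len_sumset_le => //; first exact: sumset_subr.
have sLc : submodule (sumset (F c) A).
  by apply: submodule_sumset => //; apply: filtration_submodule gF c.
apply: (finite_length_embed sLc).
  exact: (superficial_torsion nR locR nV qm gF sA sup).
apply: (fin (n := maxn n0 c)); rewrite n0P ?leq_maxl //.
apply: subset_trans (sumset_subl sA); apply: (filtration_le gF).
exact: leq_maxr.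
Qed.

(** The exact sequence of multiplication by [a2] from [V / L i] to [V / L i.+1]
    bounds [colen (L i.+1) - colen (L i)] by [colen (Q i.+1)]. This bound grows
    with [i], and for large [j] it is at most
    [colen (L j.+1) - colen (L j) + len A B]. *)
Lemma hilbert_growth : exists K, forall n k, (K <= k)%N -> (n <= k)%N ->
  (len (E n.+2) (E n.+1) + len (E k.+1) (E k) <=
   len (E k.+2) (E k.+1) + len (E n.+1) (E n) + len A B)%N.
Proof.
have [K KP] := colonL_large; exists K => n k Kk nk.
have Q_le i j : (i <= j)%N -> Q j `<=` Q i.
  move=> ij; apply: sumsetS => //; apply: sumsetS => //.
  elim: j ij => [|j IH]; first by rewrite leqn0 => /eqP->.
  by rewrite leq_eqVlt => /orP[/eqP->//|/IH]; apply: subset_trans.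
have main i j : (i <= j)%N -> (K <= j)%N ->
    (colen (L i.+1) + colen (L j) <= colen (L j.+1) + colen (L i) + len A B)%N.
  move=> ij Kj; have Kj' := KP j Kj.
  have Qij : (colen (Q i.+1) <= colen (Q j.+1))%N.
    rewrite {2}/colen (@lenD _ _ (Q j.+1) (Q i.+1)) ?leq_addl //.
    - by apply: submodule_sumset => //; apply: submodule_scaleset.
    - by apply: submodule_sumset => //; apply: submodule_scaleset.
    - exact: Q_le.
    - apply: (fin (n := j.+1)); apply: subset_trans (@EL _) _.
      by apply: sumset_subr; apply: submodule_scaleset.
  have := colenQ i.+1; have := colenQ j.+1.
  by have := colen_colon i; have := colen_colon j; lia.
by have := main n.+1 k.+1 nk (leqW Kk); rewrite !colenL.
Qed.

End Growth.

(** * Hilbert coefficients in dimension two *)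

Section SecondDifference.
Implicit Types (H : nat -> nat) (h : {poly int}).

(** The coefficients of [(1 - t)^2] times the generating series of [H]. *)
Definition second_diff H (n : nat) : int :=
  match n with
  | 0 => (H 0%N)%:Z
  | 1 => (H 1%N)%:Z - 2 * (H 0%N)%:Z
  | n'.+2 => (H n'.+2)%:Z - 2 * (H n'.+1)%:Z + (H n')%:Z
  end.

Lemma coef_second_diff H n :
  ((1 - 'X) ^+ 2 * \poly_(i < n.+1) (H i)%:Z)`_n = second_diff H n.
Proof.
set p := \poly_(i < _) _.
have -> : (1 - 'X) ^+ 2 * p = p - p * 'X *+ 2 + p * 'X * 'X by ring.
rewrite coefD coefB coefMn !coefMX /p !coef_poly.
case: n p => [|[|n]] p /=.
- by ring.
- by ring.
- by rewrite ltnSn leqnSn ltnW //; ring.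
Qed.

(** The weighted sum of coefficients which, once [n] passes the degree of [h],
    is the [i]-th Hilbert coefficient [h^`N(i).[1]]. *)
Definition weighted_sum h i n : int := \sum_(j < n) h`_j *+ 'C(j, i).

Lemma nderivn1_weighted_sum h i n : (size h <= n)%N ->
  h^`N(i).[1] = weighted_sum h i n.
Proof.
move=> hn; have tail : weighted_sum h i (i + n) = weighted_sum h i n.
  rewrite /weighted_sum addnC big_split_ord /= [X in _ + X]big1 ?addr0 // => j _.
  by rewrite nth_default ?mul0rn // (leq_trans hn) // leq_addr.
rewrite -tail /weighted_sum big_split_ord /= big1 ?add0r => [|j _]; last first.
  by rewrite bin_small.
rewrite (@horner_coef_wide _ n).
  by apply: eq_bigr => j _; rewrite coef_nderivn expr1n mulr1.
by rewrite (leq_trans (size_poly _ _)) // (leq_trans (leq_subr _ _)).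
Qed.

Section Sums.
Variables (H : nat -> nat) (h : {poly int}).
Hypothesis hH : forall n, second_diff H n = h`_n.

Lemma second_diff_value n :
  (H n)%:Z = n.+1%:Z * weighted_sum h 0 n.+1 - weighted_sum h 1 n.+1.
Proof.
suff [] : (H n)%:Z = n.+1%:Z * weighted_sum h 0 n.+1 - weighted_sum h 1 n.+1 /\
  (H n.+1)%:Z = n.+2%:Z * weighted_sum h 0 n.+2 - weighted_sum h 1 n.+2 by [].
elim: n => [|n [IH1 IH2]].
  have := hH 0%N; have := hH 1%N; rewrite /weighted_sum !big_ord_recr !big_ord0 /=.
  by rewrite !bin0 !bin1 !mulr1n mulr0n; lia.
split=> //; have := hH n.+2; rewrite /= IH1 IH2 /weighted_sum !big_ord_recr /=.
rewrite !bin0 !bin1 !mulr1n -![h`__ *+ _]mulr_natr !natz.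
move: (\sum_(i < n) _ : int) (\sum_(i < n) _ : int) => D W.
move: (h`_n : int) (h`_n.+1 : int) (h`_n.+2 : int) => x y z E.
have {}E : (H n.+2)%:Z = z + 2 * (n.+2%:Z * (W + x + y) - (D + x * n%:Z + y * n.+1%:Z))
  - (n.+1%:Z * (W + x) - (D + x * n%:Z)) by rewrite -E; lia.
by rewrite E; lia.
Qed.

(** The coefficient [h`_j] enters the left-hand side ['C(n - j + 1, 2)] times,
    which is ['C(n + 1, 2) - n j + 'C(j, 2)]. *)
Lemma second_diff_sum n :
  \sum_(k < n) (H k)%:Z = 'C(n.+1, 2)%:Z * weighted_sum h 0 n -
    n%:Z * weighted_sum h 1 n + weighted_sum h 2 n.
Proof.
elim: n => [|n IH].
  by rewrite /weighted_sum !big_ord0 !mulr0 subr0 addr0.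
have bin_sq : ('C(n.+1, 2) + 'C(n, 2) = n * n)%N.
  elim: n {IH} => // n IHn; have := binS n.+1 1; have := binS n 1.
  by rewrite !bin1; lia.
rewrite big_ord_recr /= IH second_diff_value (binS n.+1 1) bin1.
rewrite /weighted_sum !big_ord_recr /= bin0 bin1 mulr1n -![h`__ *+ _]mulr_natr !natz.
move: (\sum_(i < n) _ : int) (\sum_(i < n) _ : int) (\sum_(i < n) _ : int).
move: (h`_n : int) 'C(n.+1, 2) 'C(n, 2) bin_sq => x b c bin_sq Z W D.
have {}bin_sq : b%:Z = n%:Z * n%:Z - c%:Z by lia.
by rewrite PoszD bin_sq; lia.
Qed.

End Sums.
End SecondDifference.

Lemma binomial_poly2E (x : rat) : (binomial_poly 2).[x] = x * (x - 1) / 2.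
Proof.
rewrite /binomial_poly !big_ord_recr big_ord0 /= mul1r !hornerE (_ : 2`! = 2)%N //.
by rewrite -[LHS]/(2^-1 * x * (x - 1)); field.
Qed.

(** If [G] increases by at most [l] at each step, then going down from [t] it
    loses at most [l] each time: [G (t - j) >= - (c + j l)], to be summed. *)
Lemma sum_ge_of_growth (G : nat -> int) (l : nat) t (c : nat) :
  (forall k, G k.+1 - G k <= l%:Z) -> - c%:Z <= G t ->
  - ('C(t.+1, 2) * l + t * c)%N%:Z <= \sum_(k < t) G k.
Proof.
move=> growth; elim: t c => [|t IH] c Gt; first by rewrite big_ord0.
rewrite big_ord_recr /=; have Gt' : - (c + l)%N%:Z <= G t.
  by have := growth t; lia.
have := IH _ Gt'; rewrite (binS t.+1 1) bin1.
by move: (\sum_(i < t) _) => S; lia.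
Qed.

Lemma Posz_sum n (f : nat -> nat) :
  (\sum_(k < n) f k)%N%:Z = \sum_(k < n) (f k)%:Z.
Proof. by elim: n => [|n IH]; rewrite ?big_ord0 // !big_ord_recr /= PoszD IH. Qed.

Section DimensionTwo.
Variables (R : comNzRingType) (V : lmodType R).
Hypothesis dim2 : krull_dim V = 2%N.
Implicit Types (F E : nat -> set V).

Let H F (n : nat) : nat := hilbert_fun F n.

Lemma hilbert_numeratorE F h : is_hilbert_numerator F h <->
  h.[1] != 0 /\ forall n, second_diff (H F) n = h`_n.
Proof.
rewrite /is_hilbert_numerator dim2; split=> -[h1 hP]; split=> // n.
  by rewrite -coef_second_diff -hP.
by rewrite -hP -coef_second_diff.
Qed.

Lemma hilbert_numerator_eq F h :
  is_hilbert_numerator F h -> hilbert_numerator F = h.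
Proof.
move=> Fh; apply: xget_unique => // g /hilbert_numeratorE[_ gP].
have [_ hP] := (hilbert_numeratorE F h).1 Fh.
by apply/polyP => n; rewrite -gP -hP.
Qed.

Lemma hilbert_coef_weighted_sum F h i n : is_hilbert_numerator F h ->
  (size h <= n)%N -> hilbert_coef F i = weighted_sum h i n.
Proof.
move=> Fh hn; rewrite /hilbert_coef (hilbert_numerator_eq Fh).
exact: nderivn1_weighted_sum.
Qed.

Lemma hilbert_fun_large F h n : is_hilbert_numerator F h -> (size h <= n)%N ->
  (H F n)%:Z = n.+1%:Z * hilbert_coef F 0 - hilbert_coef F 1.
Proof.
move=> Fh hn; have [_ hP] := (hilbert_numeratorE F h).1 Fh.
by rewrite (second_diff_value hP) -!(hilbert_coef_weighted_sum _ Fh) // leqW.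
Qed.

Lemma hilbert_sum_large F h n : is_hilbert_numerator F h -> (size h <= n)%N ->
  \sum_(k < n) (H F k)%:Z = 'C(n.+1, 2)%:Z * hilbert_coef F 0 -
    n%:Z * hilbert_coef F 1 + hilbert_coef F 2.
Proof.
move=> Fh hn; have [_ hP] := (hilbert_numeratorE F h).1 Fh.
by rewrite (second_diff_sum hP) -!(hilbert_coef_weighted_sum _ Fh).
Qed.

Lemma hilbert_coef0_neq0 F h : is_hilbert_numerator F h -> hilbert_coef F 0 != 0.
Proof.
move=> Fh; rewrite /hilbert_coef (hilbert_numerator_eq Fh) nderivn0.
by case: Fh.
Qed.

Lemma hilbert_poly_horner F (x : rat) : (hilbert_poly F).[x] =
  (hilbert_coef F 0)%:~R * (x + 1) - (hilbert_coef F 1)%:~R.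
Proof.
rewrite /hilbert_poly dim2 !big_ord_recr big_ord0 /= /binomial_poly.
rewrite !big_ord_recr !big_ord0 /= !hornerE horner_comp !hornerE /=.
rewrite (_ : (2 - 0 - 1)%N = 1%N) // (_ : (2 - 1 - 1)%N = 0%N) //.
rewrite horner_comp !hornerE; congr (_ + _).
rewrite -[LHS]/((-1) ^+ 1 * _%:~R / 0`!%:R * 1).
by rewrite expr1 mulN1r invr1 !mulr1.
Qed.

(** The Hilbert function and polynomial agree from [size h] on, and they differ
    at [-1] or at [-2], where the function is zero: otherwise [e_0] would be
    zero. So there is a largest place where they differ. *)
Lemma postulation_numberP F h k : is_hilbert_numerator F h ->
  postulation_number F < k -> (hilbert_fun F k)%:R = (hilbert_poly F).[k%:~R].
Proof.
move=> Fh; pose bad n := (hilbert_fun F n)%:R != (hilbert_poly F).[n%:~R].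
have small n : bad n -> n < size h.
  move=> badn; rewrite ltNge; apply: contra badn => hn.
  case: n hn => [n|//]; rewrite lez_nat => hn.
  rewrite /hilbert_fun -/(hilbert_fun F n) hilbert_poly_horner.
  have := hilbert_fun_large Fh hn => /(f_equal (fun x : int => x%:~R : rat)).
  rewrite /H intrB intrM => E; rewrite pmulrn E -[n.+1]addn1 PoszD intrD.
  by rewrite mulrC.
have [n0 badn0] : exists n, bad n.
  have [b1|] := boolP (bad (-1)); first by exists (-1).
  have [b2|] := boolP (bad (-2)); first by exists (-2).
  rewrite /bad !hilbert_poly_horner /= !negbK => /eqP b2 /eqP b1.
  case/eqP: (hilbert_coef0_neq0 Fh); apply: (@intr_inj rat).
  by move: b1 b2; rewrite !mulrNz; lra.
have ex_j : exists j : nat, bad ((size h)%:Z - j%:Z).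
  by exists `|(size h)%:Z - n0|%N; have := small _ badn0 => ?;
     rewrite (_ : _ - _ = n0) //; lia.
have [j badj jmin] := ex_minnP ex_j.
pose top n := bad n /\ forall k : int, bad k -> k <= n.
have ex_top : exists n, top n.
  exists ((size h)%:Z - j%:Z); split=> // n badn; have := small _ badn => nh.
  have := jmin `|(size h)%:Z - n|%N; rewrite (_ : _ - _ = n); last by lia.
  by move=> /(_ badn); lia.
have [_ sP] : top (postulation_number F) by apply: xgetPex.
move=> sk; apply/eqP; apply: contraT => /sP; lia.
Qed.

Lemma hilbert_coef2_ge F h (l : nat) : is_hilbert_numerator F h ->
  (exists K, forall n k, (K <= k)%N -> (n <= k)%N ->
    (H F n.+1 + H F k <= H F k.+1 + H F n + l)%N) ->
  (hilbert_coef F 2)%:~R >=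
    - ((binomial_poly 2).[(postulation_number F + 2)%:~R] * l%:R) :> rat.
Proof.
move=> Fh [K growth]; set s := postulation_number F.
(* The least natural number beyond [s]. *)
pose t := if s is Posz s' then s'.+1 else 0%N.
pose G k := (H F k)%:Z - (k.+1%:Z * hilbert_coef F 0 - hilbert_coef F 1).
have Gt k : (t <= k)%N -> G k = 0.
  move=> tk; have sk : s < k by rewrite /t in tk; case: (s) tk => s'; lia.
  have /eqP := postulation_numberP Fh sk; rewrite hilbert_poly_horner.
  rewrite (_ : _ * _ - _ = (k.+1%:Z * hilbert_coef F 0 - hilbert_coef F 1)%:~R); last first.
    by rewrite intrB intrM -[k.+1]addn1 PoszD intrD mulrC.
  by rewrite pmulrn eqr_int => /eqP; rewrite /G /H => ->; rewrite subrr.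
have Ggrowth k : G k.+1 - G k <= l%:Z.
  pose n := maxn (size h) (maxn K k).
  have hn : (size h <= n)%N by lia.
  have := growth k n; have := hilbert_fun_large Fh hn.
  by have := hilbert_fun_large Fh (leqW hn); rewrite /G; lia.
have Gsum : hilbert_coef F 2 = \sum_(k < t) G k.
  have hn : (size h <= t + size h)%N by apply: leq_addl.
  have : \sum_(k < t + size h) G k = hilbert_coef F 2.
    rewrite /G sumrB (hilbert_sum_large Fh hn).
    rewrite (_ : \sum_(k < _) _ = 'C((t + size h).+1, 2)%:Z * hilbert_coef F 0 -
       (t + size h)%:Z * hilbert_coef F 1).
      by rewrite addrC addrA addNr add0r.
    elim: (t + size h)%N {hn} => [|n IH]; first by rewrite big_ord0 bin_small //; lia.
    by rewrite big_ord_recr IH (binS n.+1 1) bin1 /=; lia.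
  move=> <-; rewrite big_split_ord /= [X in _ + X]big1 ?addr0 // => i _.
  by apply: Gt; apply: leq_addr.
have Gt0 : - 0%N%:Z <= G t by rewrite Gt.
have := sum_ge_of_growth Ggrowth Gt0; rewrite -Gsum muln0 addn0 => e2_ge.
apply: (@le_trans _ _ (- ('C(t.+1, 2) * l)%N%:Z)%:~R); last by rewrite ler_int.
rewrite mulrNz lerN2 -pmulrn natrM ler_wpM2r // binomial_poly2E ler_pdivlMr //.
rewrite (_ : _ * (_ - 1) = ((s + 2) * (s + 2 - 1))%:~R); last by rewrite intrM intrB.
rewrite -natrM pmulrn ler_int /t; case: (s) => s'.
  by have := mul_bin_diag s'.+2 1; rewrite /= bin1; lia.
by rewrite bin_small // NegzE; nia.
Qed.

(** Second differences that vanish in large degree are the coefficients of a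
    polynomial. Its value at [1] is the slope of the Hilbert function in large
    degree, the same for both filtrations. *)
Lemma hilbert_numerator_transfer F E h n0 : is_hilbert_numerator F h ->
  (forall n, (n0 <= n)%N -> H E n = H F n) ->
  exists g, is_hilbert_numerator E g.
Proof.
move=> Fh EF; have [h1 hP] := (hilbert_numeratorE F h).1 Fh.
pose N := maxn (size h) n0.+2.
have [hN n0N] : (size h <= N)%N /\ (n0.+2 <= N)%N by rewrite leq_maxl leq_maxr.
pose g := \poly_(i < N) second_diff (H E) i.
have gP n : second_diff (H E) n = g`_n.
  rewrite coef_poly; case: ltnP => // Nn.
  transitivity (second_diff (H F) n); last by rewrite hP nth_default // (leq_trans hN).
  by case: n Nn => [|[|n]] Nn /=; rewrite !EF //; lia.
exists g; apply/hilbert_numeratorE; split=> //.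
have gN n : (N <= n)%N -> weighted_sum g 0 n = g.[1] /\
    weighted_sum g 1 n = weighted_sum g 1 N.
  move=> Nn; have gn i k : (N <= k)%N -> weighted_sum g i k = g^`N(i).[1].
    by move=> Nk; rewrite (@nderivn1_weighted_sum _ _ k) // (leq_trans (size_poly _ _)).
  by rewrite !gn // nderivn0.
have := hilbert_fun_large Fh hN; have := hilbert_fun_large Fh (leqW hN).
rewrite -!EF ?(second_diff_value gP); [|lia|lia].
have [-> ->] := gN N.+1 (leqnSn _); have [-> ->] := gN N.+2 (leqW (leqnSn _)).
move=> E1 E2; apply: contra (hilbert_coef0_neq0 Fh) => /eqP g0; apply/eqP; move: E1 E2.
by rewrite g0; move: (weighted_sum g 1 N) (N) => w k; clear; lia.
Qed.

(** In large degree the Hilbert function determines [e_0] and [e_1], and then its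
    sums determine [e_2]. *)
Lemma hilbert_coef2_eq F E h g n0 :
  is_hilbert_numerator F h -> is_hilbert_numerator E g ->
  (forall n, (n0 <= n)%N -> H E n = H F n) ->
  (forall n, (n0 <= n)%N -> (\sum_(k < n) H E k = \sum_(k < n) H F k)%N) ->
  hilbert_coef F 2 = hilbert_coef E 2.
Proof.
move=> Fh Eg EF sumEF; pose n := maxn (maxn (size h) (size g)) n0.
have [hn gn n0n] : [/\ (size h <= n)%N, (size g <= n)%N & (n0 <= n)%N].
  by split; lia.
have F1 := hilbert_fun_large Fh hn; have F2 := hilbert_fun_large Fh (leqW hn).
have E1 := hilbert_fun_large Eg gn; have E2 := hilbert_fun_large Eg (leqW gn).
have FS := hilbert_sum_large Fh hn; have ES := hilbert_sum_large Eg gn.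
rewrite -(EF _ n0n) E1 in F1; rewrite -(EF _ (leqW n0n)) E2 in F2.
have {}FS := etrans (esym ES) (etrans (etrans (esym (Posz_sum n (H E)))
  (f_equal Posz (sumEF n n0n))) (etrans (Posz_sum n (H F)) FS)).
move: F1 F2 FS; clear; move: n (hilbert_coef F) (hilbert_coef E) => n f e.
move=> F1 F2 FS; have e0 : f 0%N = e 0%N by lia.
have e1 : f 1%N = e 1%N by rewrite e0 in F1; lia.
by rewrite e0 e1 in FS; lia.
Qed.

End DimensionTwo.

Lemma sum_len (R : comNzRingType) (V : lmodType R) (F : nat -> set V) :
  (forall n, submodule (F n)) -> (forall n, F n.+1 `<=` F n) ->
  F 0%N = setT -> (forall n, finite_length (F n) setT) ->
  forall n, (\sum_(k < n) len (F k.+1) (F k) = len (F n) setT)%N.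
Proof.
move=> sF F_le F0 fin n; have sT := @submodule_setT R V; elim: n => [|n IH].
  have := lenD sT sT sT (@subset_refl _ _) (@subset_refl _ _).
  by rewrite big_ord0 -{1}F0 => /(_ (fin _)); rewrite F0; lia.
by rewrite big_ord_recr /= IH addnC -lenD.
Qed.

Theorem theorem3 (R : comNzRingType) (m q : set R) (M : lmodType R)
    (F : nat -> set M) (a1 a2 : R) (J : set R)
    (hR : noetherian R)
    (hm : local_ring m)
    (hk : infinite_residue_field m)
    (hq : primary_ideal m q)
    (hM : finitely_generated [set: M])
    (hF : good_filtration q F)
    (hdim : krull_dim M = 2%N)
    (hdepth : (0 < depth M m)%N)
    (hsup : maximal_superficial_sequence q F [:: a1; a2])
    (hJ : J = ideal_gen [set a1; a2]) :
  let s : int := postulation_number (ratliff_rush q F) in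
  let a1M : set M := smul (ideal_gen [set a1]) [set: M] in
  (hilbert_coef F 2)%:~R >=
    - ((binomial_poly 2).[(s + 2)%:~R] *
       (length_quot (colon a1M [set a2]) a1M)%:R) :> rat.
Proof.
lazy zeta; set s := postulation_number _; set a1M := smul _ _.
pose A := scaleset a1 [set: M].
have a1ME : a1M = A by apply: smul_ideal_gen1.
have nM := finitely_generated_noetherian hR hM.
have [sup12 _] := hsup.
have s0 := @submodule_set0 R M.
have sA : submodule A by apply: submodule_scaleset.
have [qa1 [c1 sup1]] : q a1 /\ exists c, superficial_mod F [set 0] a1 c.
  apply: superficial_modP => //.
  by have := sup12 0%N isT; rewrite /= prefix_mul0.
have [qa2 [c2 sup2]] : q a2 /\ exists c, superficial_mod F A a2 c.
  apply: superficial_modP => //; have := sup12 1%N isT.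
  rewrite /= (_ : prefix_mul M _ 1 = A) //.
  rewrite -a1ME /prefix_mul; congr (smul (ideal_gen _) _).
  by apply/seteqP; split=> x; rewrite /= inE => /eqP.
have [r mr reg_r] := depth_gt0_regular hdepth.
have reg1 := superficial_regular hR hm nM hq hF mr reg_r sup1.
have [n0 n0P] := regular_superficial_colon hR nM hF reg1 sup1 qa1.
pose E := ratliff_rush q F.
have EE n : E n = [set x | F (n + n0)%N (a1 ^+ n0 *: x)].
  by apply/seteqP; split=> x /(ratliff_rushE hF qa1 n0P).
have sF := filtration_submodule hF.
have F0 : F 0%N = setT by case: hF => -[].
have F_le n : F n.+1 `<=` F n by apply: (filtration_le hF).
have sE n : submodule (E n).
  by have := submodule_colon [set a1 ^+ n0] (sF (n + n0)%N); rewrite EE colon1E.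
have E0 : E 0%N = setT.
  apply/seteqP; split=> // x _; rewrite EE /= add0n; exact: (filtration_exp0 hF).
have E_le n : E n.+1 `<=` E n by rewrite !EE => x /=; rewrite addSn; apply: F_le.
have qE a n x : q a -> E n x -> E n.+1 (a *: x).
  rewrite !EE /= => qa Ex; rewrite scalerA mulrC -scalerA addSn.
  exact: (filtration_mul hF).
have E_colon n x : E n.+1 (a1 *: x) -> E n x.
  rewrite !EE /= scalerA mulrC -scalerA addSn; apply: n0P; exact: leq_addl.
have E_stable n : (n0 <= n)%N -> E n = F n.
  move=> n0n; rewrite EE; apply/seteqP; split=> x /=.
    exact: (colon_cancel n0P).
  exact: (filtration_exp hF).
have finE := finite_length_colength hR hm nM hq sE E0 qE.
have finF n : finite_length (F n) setT.
  apply: (finite_length_colength hR hm nM hq sF F0) => a k x.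
  exact: (filtration_mul hF).
have HE (n : nat) : hilbert_fun E n = len (E n.+1) (E n) by apply: length_quotE.
have HF (n : nat) : hilbert_fun F n = len (F n.+1) (F n) by apply: length_quotE.
have lE : length_quot (colon a1M [set a2]) a1M = len A (colon A [set a2]).
  rewrite a1ME; apply: length_quotE => //; first exact: submodule_colon.
  by rewrite colon1E => x; apply: submoduleZ.
(* Without a numerator, [e_2] is zero by convention, and ['C(s + 2, 2)] is
   nonnegative for every integer [s]. *)
have [[h Fh]|nFh] := pselect (exists h, is_hilbert_numerator F h); last first.
  have -> : hilbert_coef F 2 = 0.
    by rewrite /hilbert_coef /hilbert_numerator xgetPN ?linear0 ?horner0 //;
       apply/forallNP.
  rewrite oppr_le0 mulr_ge0 // binomial_poly2E divr_ge0 //.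
  rewrite (_ : _ * (_ - 1) = ((s + 2) * (s + 2 - 1))%:~R); last by rewrite intrM intrB.
  by rewrite ler0z; case: (s) => k; nia.
have EF (n : nat) : (n0 <= n)%N -> hilbert_fun E n = hilbert_fun F n.
  by move=> n0n; rewrite HE HF !E_stable // leqW.
have [g Eg] := hilbert_numerator_transfer hdim Fh EF.
rewrite lE (@hilbert_coef2_eq _ _ hdim F E h g n0) //; last first.
  move=> n n0n; under eq_bigr do rewrite HE; under [RHS]eq_bigr do rewrite HF.
  by rewrite !sum_len // E_stable.
apply: (hilbert_coef2_ge hdim Eg).
have [K growth] := hilbert_growth hR hm nM hq hF qa1 qa2 sE E0 E_le qE E_colon
  (ex_intro _ n0 E_stable) sup2.
by exists K => n k Kk nk; rewrite !HE; apply: growth.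
Qed.
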